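(* Let $d,n\in\mathbb N$ and let $\mathsf A,\mathsf B\in\mathcal M_n(\mathbb C)^d$. Let $\mathbb S_d^1=\{(\lambda,\lambda^2,\dots,\lambda^d)\in\mathbb C^d:\lambda\in\mathbb C,\ |\lambda|=1\}$ and let $\mathrm{conv}\,\mathbb S_d^1$ be its convex hull. Then (1) $\mathsf A\in\mathbb K^{\min}(\mathrm{conv}\,\mathbb S_d^1)$ if and only if $\rho(\mathsf A)\le1$, and (2) $\mathsf B\in\mathbb K^{\max}(\mathrm{conv}\,\mathbb S_d^1)$ if and only if $\omega(\mathsf B)\le1$.
   Context: $\mathcal M_n(\mathbb C)$ is identified with the bounded operators on $\mathcal H=\mathbb C^n$. Let $\mathsf T=(T_1,\dots,T_d)\in\mathcal B(\mathcal H)^d$ and $\alpha\in\mathbb R_+=[0,\infty)$. Positive means positive semidefinite. Let $\mathcal T_\alpha$ be the $(d+1)\times(d+1)$ Toeplitz operator matrix on $\bigoplus_1^{d+1}\mathcal H$ whose $(i,j)$ entry is $\alpha 1_{\mathcal H}$ if $i=j$, $T_{i-j}$ if $i>j$, and $T_{j-i}^*$ if $i<j$. The Toeplitz modulus is $\rho(\mathsf T)=\inf\{\alpha\in\mathbb R_+ : \mathcal T_\alpha\text{ is positive}\}$. For $\xi\in\mathcal H$, let $\mathcal T_{\alpha,\xi}$ be the $(d+1)\times(d+1)$ complex Toeplitz matrix whose $(i,j)$ entry is $\alpha$ if $i=j$, $\langle T_{i-j}\xi,\xi\rangle$ if $i>j$, and $\langle T_{j-i}^*\xi,\xi\rangle$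 if $i<j$. The Toeplitz numerical radius is $\omega(\mathsf T)=\inf\{\alpha\in\mathbb R_+ : \mathcal T_{\alpha,\xi}\text{ is positive for every unit vector }\xi\in\mathcal H\}$. For a compact convex set $\Omega\subseteq\mathbb C^d$, $\mathbb K^{\min}(\Omega)$ and $\mathbb K^{\max}(\Omega)$ are the smallest and largest matrix convex sets whose first level is $\Omega$. They are described as follows. A $d$-tuple $\mathsf A$ of $n\times n$ matrices is in $\mathbb K^{\min}(\Omega)$ if and only if there exist a Hilbert space $\mathcal K$ containing $\mathbb C^n$ as a subspace and a $d$-tuple $\mathsf N=(N_1,\dots,N_d)$ of commuting normal operators on $\mathcal K$ such that $A_k\xi=P_{\mathbb C^n}N_k\xi$ for all $\xi\in\mathbb C^n$ and all $k$ (a normal dilation), and $\mathrm{Sp}_G(\mathsf N)\subseteq\Omega$. Here the Gelfand joint spectrum $\mathrm{Sp}_G(\mathsf N)$ is the set of all $(\pi(N_1),\dots,\pi(N_d))$ with $\pi$ a unital homomorphism to $\mathbb C$ of the unital C$^*$-algebra generated by $N_1,\dots,N_d$. A $d$-tuple $\mathsf B$ of $n\times n$ matrices is in $\mathbb K^{\max}(\Omega)$ if and only if its joint numerical range $W(\mathsf B)=\{(\langle B_1\xi,\xi\rangle,\dots,\langle B_d\xi,\xi\rangle):\xi\in\mathbb C^n,\ \|\xi\|=1\}$ is a subset of $\Omega$. *)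

(* Defs.v *)
From mathcomp Require Import all_boot all_order all_algebra.
From mathcomp Require Import classical_sets reals complex.

Set Implicit Arguments.
Unset Strict Implicit.
Unset Printing Implicit Defensive.

Import Order.TTheory GRing.Theory Num.Theory Num.Def.

Local Open Scope classical_set_scope.
Local Open Scope complex_scope.
Local Open Scope sesquilinear_scope.
Local Open Scope ring_scope.

(* [dotmx] acts on row vectors; C^n is 'cV_n here, so that matrices act on it
   on the left.  The product is linear in its first argument, and the order of
   R[i] makes [0 <= z] mean "z is real and nonnegative". *)
Definition cdot (R : realType) (n : nat) (u v : 'cV[R[i]]_n) : R[i] :=
  dotmx u^T v^T.

Definition psd (R : realType) (n : nat) (M : 'M[R[i]]_n) : Prop :=
  forall x : 'cV[R[i]]_n, 0 <= cdot (M *m x) x.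

(* Tuples are indexed from 0: the operator T_k of a d-tuple (T_1, ..., T_d) is
   T`_k.-1, and is never out of range below. *)
Definition toeplitz_op (R : realType) (d n : nat) (a : R)
    (T : d.-tuple 'M[R[i]]_n) : 'M[R[i]]_(\sum_(i < d.+1) n) :=
  \mxblock_(i < d.+1, j < d.+1)
    (if i == j then (a%:C)%:M
     else if (j < i)%N then T`_(i - j).-1
     else (T`_(j - i).-1) ^t* : 'M[R[i]]_n).

Definition toeplitz_modulus (R : realType) (d n : nat)
    (T : d.-tuple 'M[R[i]]_n) : R :=
  inf [set a : R | 0 <= a /\ psd (toeplitz_op a T)].

Definition toeplitz_vec (R : realType) (d n : nat) (a : R)
    (T : d.-tuple 'M[R[i]]_n) (xi : 'cV[R[i]]_n) : 'M[R[i]]_d.+1 :=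
  \matrix_(i < d.+1, j < d.+1)
    (if i == j then a%:C
     else if (j < i)%N then cdot (T`_(i - j).-1 *m xi) xi
     else cdot ((T`_(j - i).-1) ^t* *m xi) xi).

Definition toeplitz_numradius (R : realType) (d n : nat)
    (T : d.-tuple 'M[R[i]]_n) : R :=
  inf [set a : R | 0 <= a /\
    forall xi : 'cV[R[i]]_n, cdot xi xi = 1 -> psd (toeplitz_vec a T xi)].

Definition conv_hull (R : realType) (V : lmodType R[i]) (E : set V) : set V :=
  [set p | exists (m : nat) (t : 'I_m -> R) (x : 'I_m -> V),
    [/\ forall i, 0 <= t i, \sum_i t i = 1, forall i, E (x i)
      & p = \sum_i (t i)%:C *: x i]].

(* The curve S_d^1; the coordinate of index k : 'I_d is the (k+1)-st one. *)
Definition moment_circle (R : realType) (d : nat) : set 'rV[R[i]]_d :=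
  [set p | exists2 z : R[i], `|z| = 1 & p = \row_(k < d) z ^+ k.+1].
Arguments moment_circle : clear implicits.

Section HilbertSpace.
Context (R : realType).

Definition dot_norm (V : lmodType R[i]) (ip : {dot V for conjC}) (x : V) : R :=
  Num.sqrt (complex.Re (ip x x)).

Definition dot_complete (V : lmodType R[i]) (ip : {dot V for conjC}) : Prop :=
  forall u : nat -> V,
    (forall e : R, 0 < e -> exists m : nat, forall p q : nat,
       (m <= p)%N -> (m <= q)%N -> dot_norm ip (u p - u q) < e) ->
    exists l : V, forall e : R, 0 < e -> exists m : nat, forall p : nat,
       (m <= p)%N -> dot_norm ip (u p - l) < e.

Record hilbertSpace := HilbertSpace {
  hsort :> lmodType R[i];
  hdot : {dot hsort for conjC};
  hcomplete : dot_complete hdot }.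

Definition hnorm (K : hilbertSpace) (x : K) : R := dot_norm (hdot K) x.

Variable K : hilbertSpace.
Implicit Types (S T : K -> K) (x y : K).

(* "The operator norm of T is at most M". *)
Definition opnorm_le T (M : R) : Prop := forall x, hnorm (T x) <= M * hnorm x.

Definition bounded_op T : Prop := linear T /\ exists M : R, opnorm_le T M.

Definition is_adjoint T S : Prop :=
  bounded_op S /\ forall x y, hdot K (T x) y = hdot K x (S y).

Definition normal_op T : Prop :=
  bounded_op T /\ exists2 S, is_adjoint T S & T \o S = S \o T.

(* Norm-closed unital *-subalgebras of the algebra of bounded operators. *)
Record unital_cstar_subalgebra (X : set (K -> K)) : Prop := {
  cstar_bounded : forall T, X T -> bounded_op T;
  cstar_one : X id;
  cstar_add : forall S T, X S -> X T -> X (S \+ T);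
  cstar_scale : forall (c : R[i]) T, X T -> X (c \*: T);
  cstar_mul : forall S T, X S -> X T -> X (S \o T);
  cstar_adj : forall S T, X T -> is_adjoint T S -> X S;
  cstar_closed : forall T, bounded_op T ->
    (forall e : R, 0 < e -> exists2 S, X S & opnorm_le (T \- S) e) -> X T }.

Definition cstar_generated (d : nat) (N : 'I_d -> K -> K) : set (K -> K) :=
  [set T | forall X : set (K -> K),
    unital_cstar_subalgebra X -> (forall k, X (N k)) -> X T].

(* Unital homomorphisms X -> C; the values of pi outside X are irrelevant. *)
Record unital_hom (X : set (K -> K)) (pi : (K -> K) -> R[i]) : Prop := {
  uhom_one : pi id = 1;
  uhom_add : forall S T, X S -> X T -> pi (S \+ T) = pi S + pi T;
  uhom_scale : forall (c : R[i]) T, X T -> pi (c \*: T) = c * pi T;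
  uhom_mul : forall S T, X S -> X T -> pi (S \o T) = pi S * pi T }.

Definition gelfand_spectrum (d : nat) (N : 'I_d -> K -> K) : set 'rV[R[i]]_d :=
  [set p | exists2 pi : (K -> K) -> R[i],
    unital_hom (cstar_generated N) pi & p = \row_(k < d) pi (N k)].

(* p is the orthogonal projection of y on the subspace E. *)
Definition is_orth_proj (E : set K) y p : Prop :=
  E p /\ forall x, E x -> hdot K (y - p) x = 0.

End HilbertSpace.

(* C^n sits in K as the range of a linear isometry iota; the last clause says
   A_k xi = P_{C^n} N_k xi. *)
Definition normal_dilation (R : realType) (d n : nat)
    (A : d.-tuple 'M[R[i]]_n) (K : hilbertSpace R)
    (iota : {linear 'cV[R[i]]_n -> K}) (N : 'I_d -> K -> K) : Prop :=
  [/\ forall u v, hdot K (iota u) (iota v) = cdot u v,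
      forall k, normal_op (N k),
      forall j k, N j \o N k = N k \o N j
    & forall k xi,
        is_orth_proj (range iota) (N k (iota xi)) (iota (tnth A k *m xi))].

Definition Kmin (R : realType) (d : nat) (Omega : set 'rV[R[i]]_d) (n : nat)
    (A : d.-tuple 'M[R[i]]_n) : Prop :=
  exists (K : hilbertSpace R) (iota : {linear 'cV[R[i]]_n -> K})
         (N : 'I_d -> K -> K),
    normal_dilation A iota N /\ gelfand_spectrum N `<=` Omega.

Definition joint_numrange (R : realType) (d n : nat)
    (B : d.-tuple 'M[R[i]]_n) : set 'rV[R[i]]_d :=
  [set p | exists2 xi : 'cV[R[i]]_n,
    cdot xi xi = 1 & p = \row_(k < d) cdot (tnth B k *m xi) xi].

Definition Kmax (R : realType) (d : nat) (Omega : set 'rV[R[i]]_d) (n : nat)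
    (B : d.-tuple 'M[R[i]]_n) : Prop :=
  joint_numrange B `<=` Omega.

(* Main.v *)
Require Import Defs.
From mathcomp Require Import all_boot all_order all_algebra.
From mathcomp Require Import boolp classical_sets reals complex.
From mathcomp Require Import ring lra.
Set Implicit Arguments.
Unset Strict Implicit.
Unset Printing Implicit Defensive.
Import Order.TTheory GRing.Theory Num.Theory.
Local Open Scope classical_set_scope.
Local Open Scope ring_scope.
Local Open Scope complex_scope.

(* A positive block Toeplitz matrix is the Gram matrix of block rows r_i; being
   Toeplitz, it makes r_i |-> r_(i+1) isometric, so that r_k = r_0 U^k for a
   unitary U.  The powers of U are the normal dilation, and for 1 x 1 blocks the
   spectral decomposition of U is the convex combination on the moment curve.

   Conversely, let N be a commuting normal dilation with joint spectrum in the
   convex hull.  By Fuglede's theorem the operator Toeplitz matrix T(N) commutes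
   with the diagonal action of all N_k and N_k^*.  If T(N) were not positive, it
   would have an approximate eigenvalue mu < 0, and the N_k would have joint
   approximate eigenvalues c_k along the same vectors.  These define a character
   of the generated C*-algebra, hence c lies in the convex hull and the scalar
   Toeplitz matrix T(c) is positive; but T(N) is close to T(c) on these vectors. *)

(** * Approximate eigenvalues of selfadjoint operators *)

(** The spectrum is reached only through approximate eigenvectors. Several eigenvalue equations are
    combined by adding their squared defects into one seminorm Q, and a further operator receives an
    approximate eigenvalue on vectors that are already nearly null for Q. This works as long as Q is
    bounded along the operator and its adjoint, which holds when both commute with the operators
    whose defects Q records; Fuglede's theorem supplies this for the adjoints, and is itself proved
    by the same mechanism. In the other direction a finite-dimensional dilation is enough: a partial
    isometry extends to a unitary because the two orthogonal complements have equal dimension, and a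
    polynomial annihilating that unitary confines its characters to the eigenvalues. *)

Section LinearProp.
Context (C : pzRingType) (U W : lmodType C) (T : U -> W) (linT : linear T).

Lemma lin0 : T 0 = 0.
Proof. by have := linT (-1) 0 0; rewrite !scaleN1r oppr0 addr0 addNr. Qed.
Lemma linD x y : T (x + y) = T x + T y.
Proof. by have := linT 1 x y; rewrite !scale1r. Qed.
Lemma linZ c x : T (c *: x) = c *: T x.
Proof. by have := linT c x 0; rewrite !addr0 lin0 addr0. Qed.
Lemma linN x : T (- x) = - T x.
Proof. by rewrite -scaleN1r linZ scaleN1r. Qed.
Lemma linB x y : T (x - y) = T x - T y.
Proof. by rewrite linD linN. Qed.
Lemma lin_sum (I : finType) (P : pred I) (f : I -> U) :
  T (\sum_(i | P i) f i) = \sum_(i | P i) T (f i).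
Proof. by apply: (big_morph T); [exact: linD | exact: lin0]. Qed.

End LinearProp.

Section RealForm.
Context (R : realType) (V : lmodType R[i]).
Implicit Types (g : V -> V -> R) (Q : V -> R) (S T A : V -> V) (x y z : V).

Definition sqmod (c : R[i]) : R := complex.Re c ^+ 2 + complex.Im c ^+ 2.

Lemma sqmod_ge0 c : 0 <= sqmod c.
Proof. by rewrite addr_ge0 ?sqr_ge0. Qed.

Lemma sqmod_real (a : R) : sqmod a%:C = a ^+ 2.
Proof. by rewrite /sqmod /= expr0n addr0. Qed.

(** The real part of a positive semidefinite hermitian form. Nothing is lost, since the imaginary
    part reappears on moving ['i] across, and all estimates stay in the ordered field [R]. *)
Record realform g : Prop := RealForm {
  rformC : forall x y, g x y = g y x;
  rformD : forall x y z, g (x + y) z = g x z + g y z;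
  rformZ : forall (a : R) x y, g (a%:C *: x) y = a * g x y;
  rformI : forall x y, g ('i *: x) ('i *: y) = g x y;
  rform_ge0 : forall x, 0 <= g x x }.

(** Squared seminorms, with (a + b)^2 <= 2 (a^2 + b^2) in place of the triangle inequality: this
    form passes to sums at once. [Q] collects the squared defects of eigenvalue equations. *)
Record sqseminorm Q : Prop := SqSeminorm {
  sqsn_ge0 : forall x, 0 <= Q x;
  sqsnD : forall x y, Q (x + y) <= 2 * (Q x + Q y);
  sqsnZ : forall c x, Q (c *: x) = sqmod c * Q x }.

Definition stable Q T := exists2 M : R, 0 <= M & forall x, Q (T x) <= M * Q x.

(** For nonnegative [Q] the strict inequality forces [0 < g x x], so the witnesses can be thought of
    as unit vectors. *)
Definition approx_null Q g :=
  forall e : R, 0 < e -> exists x, Q x < e * g x x.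

Section Stable.
Context Q (Qsn : sqseminorm Q).

Lemma stableD S T : stable Q S -> stable Q T -> stable Q (S \+ T).
Proof.
move=> [a a0 Sa] [b b0 Tb]; exists (2 * (a + b)); first lra.
move=> x; apply: (le_trans (sqsnD Qsn _ _)).
by rewrite -mulrA ler_pM2l // mulrDl lerD.
Qed.

Lemma stableZ c T : stable Q T -> stable Q (c \*: T).
Proof.
move=> [a a0 Ta]; exists (sqmod c * a); first by rewrite mulr_ge0 ?sqmod_ge0.
by move=> x; rewrite (sqsnZ Qsn) -mulrA ler_wpM2l ?sqmod_ge0.
Qed.

Lemma stable_comp S T : stable Q S -> stable Q T -> stable Q (S \o T).
Proof.
move=> [a a0 Sa] [b b0 Tb]; exists (a * b); first by rewrite mulr_ge0.
by move=> x; apply: (le_trans (Sa _)); rewrite -mulrA ler_wpM2l.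
Qed.

Lemma stable_id : stable Q id.
Proof. by exists 1 => // x; rewrite mul1r. Qed.

Lemma sqsn_sum m (f : 'I_m -> V) : Q (\sum_i f i) <= 2 ^+ m * \sum_i Q (f i).
Proof.
elim: m f => [|m IH] f.
  by rewrite !big_ord0 mulr0 -(scale0r 0) (sqsnZ Qsn) sqmod_real expr0n mul0r.
rewrite !big_ord_recl; apply: (le_trans (sqsnD Qsn _ _)).
rewrite exprS -mulrA ler_pM2l // mulrDr lerD //.
by rewrite ler_peMl ?(sqsn_ge0 Qsn) // exprn_ege1 // ler1n.
Qed.

End Stable.

Section Form.
Context g (rg : realform g).
Local Notation n x := (g x x).

Lemma rformDr x y z : g x (y + z) = g x y + g x z.
Proof. by rewrite rformC // rformD // !(rformC rg x). Qed.
Lemma rformZr (a : R) x y : g x (a%:C *: y) = a * g x y.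
Proof. by rewrite rformC // rformZ // (rformC rg x). Qed.
Lemma rformN x y : g (- x) y = - g x y.
Proof. by rewrite -scaleN1r -(rmorphN1 (real_complex R)) rformZ // mulN1r. Qed.
Lemma rformNr x y : g x (- y) = - g x y.
Proof. by rewrite rformC // rformN rformC. Qed.

(** A substitute for Cauchy-Schwarz without square roots; the free weight [s] balances a small
    vector against a large one. *)
Lemma rform_amgm (s : R) x y : 0 < s -> g x y <= (s * n x + n y / s) / 2.
Proof.
move=> s0; have := rform_ge0 rg (s%:C *: x - y).
rewrite rformD // !rformDr !rformN !rformNr !rformZ // !rformZr (rformC rg y x).
move=> h; have {h} : 0 <= (s * (s * n x) - s * g x y + (- (s * g x y) - - n y)) / s.
  by rewrite divr_ge0 // ltW.
have -> : (s * (s * n x) - s * g x y + (- (s * g x y) - - n y)) / s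
  = s * n x - 2 * g x y + n y / s by field; rewrite gt_eqF.
lra.
Qed.

Lemma rform_sqsn : sqseminorm (fun x => n x).
Proof.
split=> [x|x y|c x]; first exact: rform_ge0.
  have := rform_ge0 rg (x - y); rewrite !rformD // !rformDr !rformN !rformNr.
  rewrite (rformC rg y x); lra.
have gi0 : g x ('i *: x) = 0.
  have := rformI rg x ('i *: x); rewrite scalerA.
  have -> : 'i * 'i = -1 :> R[i] by rewrite -expr2 sqr_i.
  rewrite scaleN1r rformNr (rformC rg ('i *: x) x); lra.
have ix := rformI rg x x.
case: c => a b; rewrite (_ : _ *: x = a%:C *: x + b%:C *: ('i *: x)); last first.
  rewrite scalerA -scalerDl; congr (_ *: _).
  by apply/eqP; rewrite eq_complex /=; apply/andP; split; apply/eqP; ring.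
rewrite !rformD // !rformDr !rformZ // !rformZr gi0 (rformC rg _ x) gi0.
rewrite ix /sqmod /=; ring.
Qed.

(* If B = L - A is positive on approximately Q-null vectors, testing it on
   y = x - s B x bounds |B x|^2 by <B x, x> / s. *)
Lemma selfadjoint_step Q A t0 :
  sqseminorm Q -> linear A -> (forall x y, g (A x) y = g x (A y)) ->
  stable (fun x => n x) A -> stable Q A ->
  (forall e : R, 0 < e -> exists x, Q x < e * n x /\ t0 * n x <= g (A x) x) ->
  exists2 a : R, t0 <= a &
    approx_null (fun x => Q x + n (A x - a%:C *: x)) g.
Proof.
move=> Qsn linA saA [MA MA0 bA] [MQ MQ0 QA] null0.
(* These are the bounds that Rayleigh quotients of [A] reach on vectors of arbitrarily small
   relative [Q]. Their supremum is the eigenvalue sought. *)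
pose S : set R := [set t : R | forall e : R, 0 < e ->
                     exists x, Q x < e * n x /\ t * n x <= g (A x) x].
have Q0 := sqsn_ge0 Qsn; have n0 := rform_ge0 rg; have nsn := rform_sqsn.
have npos (e : R) x : 0 < e -> Q x < e * n x -> 0 < n x.
  by move=> e0 /(le_lt_trans (Q0 x)); rewrite pmulr_rgt0.
have ubS : ubound S (MA + 1).
  move=> t /(_ 1 ltr01)[x [/(npos _ _ ltr01) nx tx]].
  rewrite -(ler_pM2r nx); apply: (le_trans tx).
  have := rform_amgm (A x) x ltr01; rewrite mul1r divr1; have := bA x.
  have := mulr_ge0 MA0 (n0 x); have := n0 x; lra.
have St0 : S t0 by [].
have supS : has_sup S by split; [exists t0 | exists (MA + 1)].
pose lam := sup S.
have le_lam t : S t -> t <= lam by move=> St; apply: ub_le_sup => //; exact: supS.2.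
exists lam; first exact: le_lam.
move=> e e0.
pose Kb := 2 * (2 * lam ^+ 2 + 2 + MA) + 1.
pose Kq := 2 * (2 * lam ^+ 2 + 2 + MQ).
have l20 : 0 <= lam ^+ 2 by rewrite sqr_ge0.
have Kb1 : 1 <= Kb by rewrite /Kb; lra.
have Kq0 : 0 < Kq by rewrite /Kq; lra.
pose del := Num.min 1 (e / (4 * (2 + 8 * Kb))).
have del0 : 0 < del by rewrite lt_min ltr01 divr_gt0 //; lra.
have del1 : del <= 1 by rewrite ge_min lexx.
have dele : del * (4 * (2 + 8 * Kb)) <= e.
  by rewrite -ler_pdivlMr ?ge_min ?lexx ?orbT //; lra.
(* [lam] may itself lie in [S]; only strictly above it does non-membership make [B] positive on
   nearly null vectors. The price is the term [del] times [x] at the end, and [del <= 1] keeps [Kb]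
   and [Kq] independent of [del]. *)
pose L := lam + del.
have L2 : L ^+ 2 <= 2 * lam ^+ 2 + 2.
  by have := sqr_ge0 (lam - del); rewrite /L; nra.
pose B x := L%:C *: x - A x.
have nB x : n (B x) <= Kb * n x.
  apply: (le_trans (sqsnD nsn _ _)).
  rewrite (sqsnZ nsn) sqmod_real rformN rformNr opprK /Kb.
  have := bA x; have := n0 x; nra.
have QB x : Q (B x) <= Kq * Q x.
  apply: (le_trans (sqsnD Qsn _ _)); rewrite -scaleN1r !(sqsnZ Qsn) sqmod_real.
  rewrite -[X in sqmod X](rmorphN1 (real_complex R)) sqmod_real sqrrN expr1n.
  rewrite mul1r /Kq; have := QA x; have := Q0 x; nra.
have gB x y : g (B x) y = L * g x y - g (A x) y by rewrite rformD // rformZ // rformN.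
have saB x y : g (B x) y = g x (B y).
  by rewrite gB rformDr rformZr rformNr saA.
have BD x (a : R) y : B (x + a%:C *: y) = B x + a%:C *: B y.
  rewrite /B (linD linA) (linZ linA) scalerBr scalerDr !scalerA mulrC opprD.
  by rewrite addrACA.
have AE x : A x = L%:C *: x - B x by rewrite /B subKr.
clearbody B.
have [e1 e10 Bpos] : exists2 e1 : R, 0 < e1 &
    forall x, Q x < e1 * n x -> 0 < g (B x) x.
  have : ~ S L by move/le_lam; rewrite /L; lra.
  move=> /existsNP[e1 /not_implyP[e10 /forallNP h]]; exists e1 => // x Qx.
  have /not_andP[//|/negP] := h x.
  by rewrite -ltNge gB subr_gt0.
(* With [s * Kb = 1 / 2] the second order term of the form at [y] is at most half of the first order
   gain [2 * s * n (B x)], and [n x <= 4 * n y]. *)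
pose s := (2 * Kb)^-1.
have s0 : 0 < s by rewrite invr_gt0; lra.
have sK : s * Kb = 1 / 2 by rewrite /s; field; rewrite gt_eqF //; lra.
(* As [Q y <= c / 4 * Q x] and [n x <= 4 * n y], a vector with [Q x < e1 / c * n x] yields a [y] to
   which [Bpos] applies. *)
pose c := 4 * (2 + 2 * s ^+ 2 * Kq).
have c0 : 0 < c by rewrite /c; nra.
pose e2 := Num.min (e1 / c) (e / 4).
have e20 : 0 < e2 by rewrite lt_min !divr_gt0.
have e21 : e2 * c <= e1 by rewrite -ler_pdivlMr ?ge_min ?lexx.
have e2e : e2 <= e / 4 by rewrite ge_min lexx orbT.
have [t St tlam] : exists2 t, S t & lam - del < t by apply: sup_adherent.
have [x [Qx tx]] := St _ e20.
have nx := npos _ _ e20 Qx.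
have gBx : g (B x) x <= 2 * del * n x by rewrite gB /L; nra.
pose y := x + (- s)%:C *: B x.
have nxy : n x <= 4 * n y.
  have := sqsnD nsn y (s%:C *: B x); rewrite (sqsnZ nsn) sqmod_real.
  have -> : y + s%:C *: B x = x by rewrite /y rmorphN scaleNr subrK.
  have := nB x; have : s ^+ 2 * Kb <= 1 / 4; last nra.
  by rewrite expr2 -mulrA sK; nra.
have Qy : Q y < e1 * n y.
  have := sqsnD Qsn x ((- s)%:C *: B x); rewrite -/y (sqsnZ Qsn) sqmod_real sqrrN.
  have h1 : s ^+ 2 * Q (B x) <= s ^+ 2 * Kq * Q x.
    by rewrite -mulrA ler_wpM2l ?sqr_ge0.
  have h2 : Q x * c < e2 * c * n x by rewrite mulrAC ltr_pM2r.
  have h3 : e2 * c * n x <= e1 * (4 * n y) by apply: ler_pM => //; apply: mulr_ge0; exact: ltW.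
  rewrite /c in h2 h3 *; nra.
have := Bpos _ Qy.
have -> : g (B y) y = g (B x) x - 2 * s * n (B x) + s ^+ 2 * g (B (B x)) (B x).
  rewrite /y BD rformD // !rformDr !rformZ // !rformZr (saB (B x) x); ring.
have : s ^+ 2 * g (B (B x)) (B x) <= s * n (B x).
  rewrite expr2 -mulrA ler_pM2l //.
  have := rform_amgm (B (B x)) (B x) ltr01; rewrite mul1r divr1.
  have := nB (B x) => h1 h2.
  have h3 : g (B (B x)) (B x) <= Kb * n (B x) by have := n0 (B x); nra.
  apply: (le_trans (ler_wpM2l (ltW s0) h3)); rewrite mulrA sK.
  by have := n0 (B x); lra.
move=> h1 h2; have h3 : s * n (B x) <= 2 * del * n x by lra.
have h4 : n (B x) <= 4 * Kb * del * n x.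
  rewrite -(ler_pM2l s0); apply: (le_trans h3).
  have -> : s * (4 * Kb * del * n x) = (s * Kb) * (4 * del * n x) by ring.
  by rewrite sK; lra.
exists x.
have -> : A x - lam%:C *: x = del%:C *: x - B x.
  by rewrite AE /L rmorphD scalerDl addrAC [_ + del%:C *: x]addrC addrK.
have := sqsnD nsn (del%:C *: x) (- B x).
rewrite (sqsnZ nsn) sqmod_real (rformN (B x)) rformNr opprK.
have h5 : del * (2 + 8 * Kb) * n x <= e / 4 * n x by rewrite ler_pM2r //; lra.
have h6 : del ^+ 2 * n x <= del * n x by rewrite ler_pM2r // expr2; nra.
have h7 : e2 * n x <= e / 4 * n x by rewrite ler_pM2r.
have h8 : 0 < e * n x by rewrite mulr_gt0.
lra.
Qed.

End Form.
End RealForm.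

(** * Normal operators *)

Section Normal.
Context (R : realType) (V : lmodType R[i]).
Context (g : V -> V -> R) (rg : realform g).
Implicit Types (Q : V -> R) (S T A W : V -> V) (x y z : V) (c : R[i]).
Local Notation n x := (g x x).
Local Notation nsq := (fun x => g x x).

Lemma sqsn_addf Q1 Q2 : sqseminorm Q1 -> sqseminorm Q2 ->
  sqseminorm (fun x => Q1 x + Q2 x).
Proof.
move=> [p1 d1 z1] [p2 d2 z2]; split=> [x|x y|c x]; first by rewrite addr_ge0.
  by have := d1 x y; have := d2 x y; lra.
by rewrite z1 z2 mulrDr.
Qed.

Lemma sqsn_comp Q T : sqseminorm Q -> linear T -> sqseminorm (Q \o T).
Proof.
move=> [p d z] lT; split=> [x|x y|c x] /=; first exact: p.
  by rewrite (linD lT).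
by rewrite (linZ lT).
Qed.

Lemma sqsn0 : sqseminorm (fun _ : V => 0 : R).
Proof. by split=> // *; rewrite ?addr0 ?mulr0. Qed.

Lemma linear_shift T c : linear T -> linear (fun x => T x - c *: x).
Proof.
move=> lT a x y; rewrite lT scalerBr scalerDr !scalerA mulrC.
by rewrite addrACA opprD.
Qed.

Lemma sqsn_shift T c : linear T -> sqseminorm (fun x => n (T x - c *: x)).
Proof. by move=> lT; apply: (sqsn_comp (rform_sqsn rg)); exact: linear_shift. Qed.

Lemma stable_addf Q1 Q2 T : sqseminorm Q1 -> sqseminorm Q2 ->
  stable Q1 T -> stable Q2 T -> stable (fun x => Q1 x + Q2 x) T.
Proof.
move=> s1 s2 [a a0 ha] [b b0 hb]; exists (a + b); first exact: addr_ge0.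
move=> x; have := ha x; have := hb x.
have := mulr_ge0 a0 (sqsn_ge0 s2 x); have := mulr_ge0 b0 (sqsn_ge0 s1 x); lra.
Qed.

Lemma stable_shift T W c : linear W -> (forall x, T (W x) = W (T x)) ->
  stable nsq W -> stable (fun x => n (T x - c *: x)) W.
Proof.
move=> lW cTW [M M0 bW]; exists M => // x.
by rewrite cTW -(linZ lW) -(linB lW).
Qed.

Lemma approx_null_le (C : R) Q1 Q2 : 0 < C -> (forall x, Q2 x <= C * Q1 x) ->
  approx_null Q1 g -> approx_null Q2 g.
Proof.
move=> C0 le12 h e e0; have [x hx] := h _ (divr_gt0 e0 C0).
exists x; apply: (le_lt_trans (le12 x)).
by rewrite mulrC -ltr_pdivlMr // mulrAC.
Qed.

Lemma rform_iswap x y : g ('i *: x) y = - g x ('i *: y).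
Proof.
rewrite -(rformI rg ('i *: x)) scalerA -expr2 sqr_i scaleN1r.
by rewrite (rformN rg).
Qed.

Lemma scale_complex (a b : R) x : (a +i* b) *: x = a%:C *: x + b%:C *: ('i *: x).
Proof.
rewrite scalerA -scalerDl; congr (_ *: _).
by apply/eqP; rewrite eq_complex /=; apply/andP; split; apply/eqP; ring.
Qed.

Lemma rform_conj c x y : g (c *: x) y = g x (conjc c *: y).
Proof.
case: c => a b; rewrite (scale_complex a b) (rformD rg) !(rformZ rg) rform_iswap.
have -> : conjc (a +i* b) = a +i* - b by [].
rewrite (scale_complex a (- b)) (rformDr rg) !(rformZr rg).
by rewrite mulrN mulNr.
Qed.

(** The adjoint is carried as data. Its relation for the real part extends to the hermitian form by
    linearity, replacing [y] by ['i *: y]. *)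
Record normal_pair T S : Prop := NormalPair {
  np_lin : linear T;
  np_lin' : linear S;
  np_adj : forall x y, g (T x) y = g x (S y);
  np_bd : stable nsq T;
  np_bd' : stable nsq S;
  np_comm : forall x, T (S x) = S (T x) }.

Lemma np_adj' T S : normal_pair T S -> forall x y, g (S x) y = g x (T y).
Proof. by move=> np x y; rewrite rformC // -(np_adj np) rformC. Qed.

Lemma normal_pair_norm T S : normal_pair T S -> forall x, n (T x) = n (S x).
Proof. by move=> np x; rewrite (np_adj np) -(np_comm np) (np_adj' np). Qed.

Lemma stable_nshift T c : stable nsq T -> stable nsq (fun x => T x - c *: x).
Proof.
have nsn := rform_sqsn rg => bT.
have -> : (fun x => T x - c *: x) = T \+ ((- c) \*: (@id V)).
  by apply/funext => x /=; rewrite scaleNr.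
by apply: (stableD nsn) => //; apply: (stableZ nsn); exact: stable_id.
Qed.

Lemma normal_pair_shift T S c : normal_pair T S ->
  normal_pair (fun x => T x - c *: x) (fun x => S x - conjc c *: x).
Proof.
move=> [lT lS aTS bT bS cTS]; split; try exact: linear_shift.
- move=> x y; rewrite rformD // rformDr // (rformN rg) (rformNr rg) aTS.
  by rewrite rform_conj.
- exact: stable_nshift.
- exact: stable_nshift.
- move=> x; rewrite (linB lT) (linB lS) (linZ lT) (linZ lS) cTS !scalerBr !scalerA.
  by rewrite (mulrC c) !opprD !addrA; congr (_ + _); rewrite addrAC.
Qed.

(** [T] is (A + i B) / 2 with A = T + S and B = - i (T - S) selfadjoint. By normality they commute,
    so B is stable for the seminorm enlarged by the defect of A, and [selfadjoint_step] applies a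
    second time. *)
Lemma normal_step Q T S : sqseminorm Q -> normal_pair T S ->
  stable Q T -> stable Q S -> approx_null Q g ->
  exists c, approx_null (fun x => Q x + n (T x - c *: x)) g.
Proof.
move=> Qsn np QT QS null.
have [lT lS aTS bT bS cTS] := np; have aST := np_adj' np.
have nsn := rform_sqsn rg; have n0 := rform_ge0 rg.
have step Q1 A : sqseminorm Q1 -> linear A -> (forall x y, g (A x) y = g x (A y)) ->
    stable nsq A -> stable Q1 A -> approx_null Q1 g ->
    exists a : R, approx_null (fun x => Q1 x + n (A x - a%:C *: x)) g.
  move=> s1 lA sA [M M0 bA] QA null1.
  (* All Rayleigh quotients of [A] are above [- (M + 1)], so this threshold imposes nothing. *)
  have [||a _ ha] := selfadjoint_step rg (t0 := - (M + 1)) s1 lA sA _ QA.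
  - by exists M.
  - move=> e /null1 [x hx]; exists x; split=> //.
    have := rform_amgm rg (- A x) x ltr01.
    rewrite mul1r divr1 !(rformN rg) (rformNr rg) opprK.
    by have := bA x; have := n0 x; have := mulr_ge0 M0 (n0 x); lra.
  by exists a.
pose A := T \+ S.
have lA : linear A by move=> a x y; rewrite /A /= lT lS scalerDr addrACA.
have [||||a ha] := step Q A Qsn lA.
- by move=> x y; rewrite /A /= rformD // rformDr // aTS aST addrC.
- exact: stableD.
- exact: stableD.
- by [].
pose Q1 x := Q x + n (A x - a%:C *: x).
have sn1 : sqseminorm Q1 by apply: sqsn_addf => //; exact: sqsn_shift.
pose B := (- 'i) \*: (T \+ (-1) \*: S).
have BE x : B x = - 'i *: (T x - S x) by rewrite /B /= scaleN1r.
have iB x : 'i *: B x = T x - S x.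
  by rewrite BE scalerA mulrN -expr2 sqr_i opprK scale1r.
have lB : linear B.
  move=> u x y; rewrite !BE lT lS scalerA [u * _]mulrC -scalerA -scalerDr.
  by congr (_ *: _); rewrite scalerBr opprD addrACA.
have bB P : sqseminorm P -> stable P T -> stable P S -> stable P B.
  by move=> sP PT PS; apply: stableZ => //; apply: stableD => //; exact: stableZ.
have [||||b hb] := step Q1 B sn1 lB.
- move=> x y; rewrite !BE !scaleNr (rformN rg) (rformNr rg) rform_iswap opprK.
  rewrite rformD // (rformN rg) aTS aST (linZ lT) (linZ lS) -(rformNr rg).
  by rewrite -(rformDr rg) -(rformNr rg) -scalerBr -scalerN opprB.
- exact: bB.
- apply: stable_addf => //; first exact: sqsn_shift; first exact: bB.
  apply: stable_shift => //; last exact: bB.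
  move=> x; rewrite !BE (linZ lA); congr (_ *: _).
  by rewrite (linB lA) /A /= (linD lT) (linD lS) !cTS.
- by [].
exists ((a +i* b) / 2); apply: approx_null_le hb => [|x]; first exact: ltr01.
rewrite mul1r /Q1 -addrA lerD2l.
set c := _ / _.
have -> : T x - c *: x
    = 2^-1 *: ((A x - a%:C *: x) + 'i *: (B x - b%:C *: x)).
  have -> : A x - a%:C *: x + 'i *: (B x - b%:C *: x)
      = (T x + T x) - (a +i* b) *: x.
    rewrite scalerBr iB /A /= scale_complex opprD addrACA; congr (_ + _).
      by rewrite addrACA subrr addr0.
    by rewrite !scalerA mulrC.
  rewrite scalerBr -mulr2n -[T x *+ 2]scaler_nat !scalerA mulVf ?pnatr_eq0 // scale1r.
  by rewrite mulrC.
rewrite (sqsnZ nsn).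
have -> : sqmod (2^-1 : R[i]) = 1 / 4.
  have -> : (2^-1 : R[i]) = (2^-1 : R)%:C by rewrite fmorphV rmorph_nat.
  by rewrite sqmod_real; field.
have := sqsnD nsn (A x - a%:C *: x) ('i *: (B x - b%:C *: x)).
rewrite (rformI rg).
have := n0 (A x - a%:C *: x); have := n0 (B x - b%:C *: x); lra.
Qed.

(** Induction on [m]: the seminorm recording the equations found so far remains stable under the
    next operator and its adjoint, as both commute with the earlier operators. The adjoint matters
    because [normal_step] works with selfadjoint parts. *)
Lemma joint_approx_eigenvalue (N N' : nat -> V -> V) Q :
  (forall k, normal_pair (N k) (N' k)) ->
  (forall j k x, N j (N k x) = N k (N j x)) ->
  (forall j k x, N j (N' k x) = N' k (N j x)) ->
  sqseminorm Q -> (forall k, stable Q (N k)) -> (forall k, stable Q (N' k)) ->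
  approx_null Q g -> forall m, exists c : nat -> R[i],
    approx_null (fun x => Q x + \sum_(k < m) n (N k x - c k *: x)) g.
Proof.
move=> np cNN cNN' Qsn QN QN' null.
elim=> [|m [c hc]].
  by exists (fun=> 0) => e /null[x hx]; exists x; rewrite big_ord0 addr0.
pose Qk (a : nat -> R[i]) k x := Q x + \sum_(i < k) n (N i x - a i *: x).
have Qk_ok k : sqseminorm (Qk c k) /\
    forall W, linear W -> stable nsq W -> stable Q W ->
      (forall j x, N j (W x) = W (N j x)) -> stable (Qk c k) W.
  elim: k => [|k [sk stk]].
    rewrite /Qk (_ : (fun x => _) = Q) //.
    by apply/funext => x; rewrite big_ord0 addr0.
  rewrite /Qk (_ : (fun x => _) = fun x => Qk c k x + n (N k x - c k *: x)).
    split; first by apply: sqsn_addf => //; apply: sqsn_shift; exact: np_lin (np k).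
    move=> W lW bW QW cW; apply: stable_addf => //; last exact: stable_shift.
    - by apply: sqsn_shift; exact: np_lin (np k).
    - exact: stk.
  by apply/funext => x; rewrite big_ord_recr /= addrA.
have [sm stm] := Qk_ok m.
have [lN lN'] := (fun k => np_lin (np k), fun k => np_lin' (np k)).
have [cm hcm] := normal_step sm (np m)
  (stm _ (lN m) (np_bd (np m)) (QN m) (fun j => cNN j m))
  (stm _ (lN' m) (np_bd' (np m)) (QN' m) (fun j => cNN' j m)) hc.
exists (fun k => if k == m then cm else c k).
apply: approx_null_le ltr01 _ hcm => x; rewrite mul1r big_ord_recr /= eqxx.
rewrite /Qk -addrA lerD2l lerD2r le_eqVlt; apply/orP; left; apply/eqP.
by apply: eq_bigr => i _; rewrite ltn_eqF.
Qed.

Hypothesis g_def : forall x, n x = 0 -> x = 0.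

Lemma rform_inj x y : (forall z, g x z = g y z) -> x = y.
Proof.
move=> h; apply/eqP; rewrite -subr_eq0; apply/eqP/g_def.
by rewrite (rformD rg) (rformN rg) h subrr.
Qed.

(* C = [T, S2] is normal and commutes with T2 and S; at a joint approximate
   eigenvector of C and T the two terms of <C x, x> cancel, so that the
   spectrum of C is {0}. *)
Lemma fuglede T S T2 S2 : normal_pair T S -> normal_pair T2 S2 ->
  (forall x, T (T2 x) = T2 (T x)) -> forall x, T (S2 x) = S2 (T x).
Proof.
move=> np1 np2 cT.
have [lT lS aTS bT bS cTS] := np1; have aST := np_adj' np1.
have [lT2 lS2 aTS2 bT2 bS2 cTS2] := np2; have aST2 := np_adj' np2.
have nsn := rform_sqsn rg; have n0 := rform_ge0 rg.
have cS x : S (S2 x) = S2 (S x).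
  by apply: rform_inj => z; rewrite aST aST2 aST2 aST cT.
pose C x := T (S2 x) - S2 (T x).
pose D x := T2 (S x) - S (T2 x).
have CT2 x : C (T2 x) = T2 (C x).
  by rewrite /C (linB lT2) -cT !cTS2 cT.
have CS x : C (S x) = S (C x).
  by rewrite /C (linB lS) -cTS !cS -cTS.
have DS2 x : D (S2 x) = S2 (D x).
  by rewrite /D (linB lS2) cS !cTS2 cS.
have DT x : D (T x) = T (D x).
  by rewrite /D (linB lT) cT !cTS cT.
have lC : linear C.
  by move=> a x y; rewrite /C lS2 !lT lS2 scalerBr opprD addrACA.
have lD : linear D.
  by move=> a x y; rewrite /D lT2 !lS lT2 scalerBr opprD addrACA.
have npC : normal_pair C D.
  split=> //.
  - move=> x y; rewrite /C /D (rformD rg) (rformDr rg) (rformN rg) (rformNr rg).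
    by rewrite aTS aST2 aST2 aTS.
  - rewrite (_ : C = (T \o S2) \+ (-1) \*: (S2 \o T)); last first.
      by apply/funext => x /=; rewrite scaleN1r.
    by apply: (stableD nsn); [|apply: (stableZ nsn)]; exact: stable_comp.
  - rewrite (_ : D = (T2 \o S) \+ (-1) \*: (S \o T2)); last first.
      by apply/funext => x /=; rewrite scaleN1r.
    by apply: (stableD nsn); [|apply: (stableZ nsn)]; exact: stable_comp.
  - by move=> x; rewrite {1}/D (linB lC) CT2 CS CS CT2.
have [_ _ aCD bC bD cCD] := npC.
suff C0 x : n (C x) = 0 by move=> x; apply/subr0_eq/g_def/C0.
apply: contrapT => /eqP nC0.
have nCx : 0 < n (C x) by rewrite lt_neqAle eq_sym nC0 n0.
have nx : 0 < n x.
  rewrite lt_neqAle n0 andbT; apply: contra_neq nC0 => /esym/g_def->.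
  by rewrite (lin0 lC) -(scale0r (0 : V)) (sqsnZ nsn) sqmod_real expr0n mul0r.
(* [D \o C] is selfadjoint with a positive Rayleigh quotient at [x], hence has a positive
   approximate eigenvalue [p]. It forces the joint approximate eigenvalue [gam] of [C] to be
   nonzero. *)
have [|||||p p0 hp] := selfadjoint_step rg (t0 := n (C x) / n x) (A := D \o C) sqsn0.
- by move=> a y z /=; rewrite lC lD.
- by move=> y z /=; rewrite (np_adj' npC) aCD.
- exact: stable_comp.
- by exists 0 => // y; rewrite mul0r.
- move=> e e0; exists x; split; first by rewrite mulr_gt0.
  by rewrite divfK ?gt_eqF //= (np_adj' npC).
have {}p0 : 0 < p by apply: lt_le_trans p0; exact: divr_gt0.
have lDC : linear (D \o C) by move=> a y z /=; rewrite lC lD.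
have {}hp : approx_null (fun y => n (D (C y) - p%:C *: y)) g.
  by apply: approx_null_le ltr01 _ hp => y /=; rewrite add0r mul1r.
have sP : sqseminorm (fun y => n (D (C y) - p%:C *: y)).
  exact: (sqsn_shift _ lDC).
have [||gam hgam] := normal_step sP npC _ _ hp.
- exact: (stable_shift (T := D \o C) p%:C lC (fun y => esym (cCD (C y))) bC).
- exact: (stable_shift (T := D \o C) p%:C lD (fun y => congr1 D (cCD y)) bD).
have {hp hgam} [gam0 hgam] : 0 < sqmod gam /\ approx_null (fun y => n (C y - gam *: y)) g.
  split; last first.
    apply: approx_null_le ltr01 _ hgam => y; rewrite mul1r lerDr; exact: n0.
  rewrite lt_neqAle sqmod_ge0 andbT eq_sym; apply/eqP => g0.
  have [M M0 hM] := bD.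
  pose e := p ^+ 2 / (4 * (M + 1)).
  have e0 : 0 < e by rewrite divr_gt0 ?exprn_gt0 //; lra.
  have [y hy] := hgam _ e0.
  have ny : 0 < n y.
    have := le_lt_trans (addr_ge0 (n0 _) (n0 _)) hy.
    by rewrite pmulr_rgt0.
  have nCy : n (C y) <= 2 * n (C y - gam *: y).
    have := sqsnD nsn (C y - gam *: y) (gam *: y).
    by rewrite subrK (sqsnZ nsn) g0 mul0r addr0.
  have := sqsnD nsn (p%:C *: y - D (C y)) (D (C y)).
  rewrite subrK (sqsnZ nsn) sqmod_real.
  have -> : n (p%:C *: y - D (C y)) = n (D (C y) - p%:C *: y).
    by rewrite -opprB (rformN rg) (rformNr rg) opprK.
  have hDC := hM (C y).
  have ee : e * (4 * (M + 1)) = p ^+ 2 by rewrite divfK // gt_eqF //; lra.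
  rewrite -ee {ee p0 nx nCx}; have := n0 (D (C y) - p%:C *: y).
  have := n0 (C y - gam *: y) => a1 a2 a3.
  have a4 : M * n (C y) <= M * (2 * n (C y - gam *: y)) by rewrite ler_wpM2l.
  have a5 : (M + 1) * (n (D (C y) - p%:C *: y) + n (C y - gam *: y)) < (M + 1) * (e * n y).
    by rewrite ltr_pM2l //; lra.
  have a6 := mulr_ge0 M0 a2.
  lra.
(* [C] commutes with [S], and [D] with [T]. By normality [Q] is also the defect of [D] at the
   conjugate of [gam], hence stable under both [T] and [S]. *)
pose Q y := n (C y - gam *: y).
have QE y : Q y = n (D y - conjc gam *: y).
  exact: normal_pair_norm (normal_pair_shift gam npC) y.
have [||lam hlam] := normal_step (sqsn_shift gam lC) np1 _ _ hgam.
- have [M M0 hM] := stable_shift (conjc gam) lT DT bT.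
  by exists M => // y; rewrite -!/(Q _) !QE.
- exact: stable_shift.
pose G := sqmod gam.
have [M M0 hM] := bS2.
(* These constants make the three terms of [key], bounded by [rform_amgm] with weights 1/s, s, 1/s,
   add up to at most half of [n u]. *)
pose s := G / (2 * (2 * G + M)).
pose e := s * G / (2 * (1 + G + M)).
have G0 : 0 < G by [].
have s0 : 0 < s by rewrite divr_gt0 //; lra.
have e0 : 0 < e by apply: divr_gt0; [exact: mulr_gt0 | lra].
have sE : s * (2 * G + M) = G / 2 by rewrite /s; field; rewrite gt_eqF //; lra.
have eE : e / s * (1 + G + M) = G / 2.
  rewrite /e; field; rewrite !gt_eqF //; lra.
have [y hy] := hlam _ e0.
have ny : 0 < n y.
  by have := le_lt_trans (addr_ge0 (n0 _) (n0 _)) hy; rewrite pmulr_rgt0.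
pose u := gam *: y; pose w := S u - conjc lam *: u.
have nu : n u = G * n y by rewrite (sqsnZ nsn).
have nw : n w = G * n (T y - lam *: y).
  rewrite -(normal_pair_norm (normal_pair_shift lam np1)).
  by rewrite (linZ lT) scalerA mulrC -scalerA -scalerBr (sqsnZ nsn).
rewrite -/u in hy; clearbody u.
(* Moving [T] across the form turns <T S2 y, u> into <S2 y, S u>; then [lam] contributes the same to
   both halves of the commutator and cancels. *)
have key : n u = g (u - C y) u + g (S2 y) w + g (- S2 (T y - lam *: y)) u.
  have -> : g (S2 y) w = g (T (S2 y)) u - g (lam *: S2 y) u.
    by rewrite (rformDr rg) (rformNr rg) -rform_conj aTS.
  rewrite (linB lS2) (linZ lS2) opprB /C.
  rewrite !(rformD rg) !(rformN rg) (rformD rg) (rformN rg).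
  ring.
have si : 0 < s^-1 by rewrite invr_gt0.
have := rform_amgm rg (u - C y) u si.
have := rform_amgm rg (S2 y) w s0.
have := rform_amgm rg (- S2 (T y - lam *: y)) u si.
rewrite invrK nw -(opprB (C y)) !(rformN rg) !(rformNr rg) !opprK.
move: hy key (hM y) (hM (T y - lam *: y)) (n0 (C y - u)) (n0 (T y - lam *: y)).
rewrite -(opprB (C y)) !(rformN rg) nu.
move: (n (C y - u)) (n (T y - lam *: y)) (n (S2 y)) (n (S2 (T y - lam *: y))).
move: (g (C y - u) u) (g (S2 y) w) (g (S2 (T y - lam *: y)) u).
clear hM Q QE hgam hlam nu nw gam0; clearbody G s e.
move: (n y) ny s e G M s0 e0 G0 M0 sE eE si; clear.
move=> ny ny0 s e G M s0 e0 G0 M0 sE eE si g1 g2 g3 X Z m1 m2 hy key b1 b2 X0 Z0 h3 h2 h1.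
have k1 : s^-1 * m2 <= s^-1 * (M * Z) by rewrite ler_pM2l.
have k2 : s * m1 <= s * (M * ny) by rewrite ler_pM2l.
have k3 : s^-1 * (1 + G + M) * (X + Z) <= s^-1 * (1 + G + M) * (e * ny).
  apply: ler_wpM2l; [apply: mulr_ge0; [exact: ltW | lra] | exact: ltW].
have k4 : s * (2 * G + M) * ny = G / 2 * ny by rewrite sE.
have k5 : s^-1 * (1 + G + M) * (e * ny) = G / 2 * ny by rewrite -eE; ring.
have k6 : 0 <= s^-1 * ((G + M) * X).
  by apply: mulr_ge0; [exact: ltW | apply: mulr_ge0 => //; lra].
have k7 : 0 <= s^-1 * Z by apply: mulr_ge0 => //; exact: ltW.
have k8 : 0 < G * ny by rewrite mulr_gt0.
move: h1 h2 h3 key k1 k2 k3 k4 k5 k6 k7 k8; clear; lra.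
Qed.

End Normal.

(** * Completeness and Hilbert spaces *)

Section Complete.
Context (R : realType).

(** The limit is obtained as the limit inferior, the supremum of the eventual lower bounds. *)
Lemma real_cauchy_cvg (u : nat -> R) :
  (forall e : R, 0 < e -> exists m : nat, forall p q : nat,
    (m <= p)%N -> (m <= q)%N -> `|u p - u q| < e) ->
  exists l : R, forall e : R, 0 < e -> exists m : nat, forall p : nat,
    (m <= p)%N -> `|u p - l| < e.
Proof.
move=> cu.
pose E : set R := [set x : R | exists m : nat, forall p : nat, (m <= p)%N -> x <= u p].
have ubE (e : R) m : (forall p q : nat, (m <= p)%N -> (m <= q)%N -> `|u p - u q| < e) ->
    ubound E (u m + e) /\ E (u m - e).
  move=> h; split=> [x [m' hx]|]; last first.
    exists m => p mp; have := h p m mp (leqnn m).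
    by rewrite ltr_norml => /andP[]; lra.
  have := h (maxn m m') m (leq_maxl _ _) (leqnn m).
  have := hx _ (leq_maxr m m').
  by rewrite ltr_norml => ? /andP[]; lra.
have [m1 h1] := cu 1 ltr01.
have [ub1 E1] := ubE _ _ h1.
have supE : has_sup E by split; [exists (u m1 - 1) | exists (u m1 + 1)].
exists (sup E) => e e0; have [m h] := cu (e / 2) (divr_gt0 e0 (ltr0n _ 2)).
have [ubm Em] := ubE _ _ h.
exists m => p mp; have := h p m mp (leqnn m).
have := ge_sup supE.1 ubm; have := ub_le_sup supE.2 Em.
by rewrite !ltr_norml => ? ? /andP[]; lra.
Qed.

Lemma sqmod_lt_norm (c : R[i]) (e : R) : 0 < e -> sqmod c < e ^+ 2 ->
  `|complex.Re c| < e /\ `|complex.Im c| < e.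
Proof.
move=> e0; rewrite /sqmod => h.
have := sqr_ge0 (complex.Re c); have := sqr_ge0 (complex.Im c).
have k (x : R) : x ^+ 2 < e ^+ 2 -> `|x| < e.
  by rewrite -[x ^+ 2]real_normK ?num_real // ltr_pXn2r ?nnegrE // ltW.
by move=> ? ?; split; apply: k; lra.
Qed.

Lemma complex_cauchy_cvg (u : nat -> R[i]) :
  (forall e : R, 0 < e -> exists m : nat, forall p q : nat,
    (m <= p)%N -> (m <= q)%N -> sqmod (u p - u q) < e) ->
  exists l : R[i], forall e : R, 0 < e -> exists m : nat, forall p : nat,
    (m <= p)%N -> sqmod (u p - l) < e.
Proof.
move=> cu.
have [|a ha] := real_cauchy_cvg (u := fun k => complex.Re (u k)).
  move=> e e0; have [m h] := cu _ (exprn_gt0 2 e0); exists m => p q mp mq.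
  by have [+ _] := sqmod_lt_norm e0 (h p q mp mq); rewrite raddfB.
have [|b hb] := real_cauchy_cvg (u := fun k => complex.Im (u k)).
  move=> e e0; have [m h] := cu _ (exprn_gt0 2 e0); exists m => p q mp mq.
  by have [_] := sqmod_lt_norm e0 (h p q mp mq); rewrite raddfB.
exists (a +i* b) => e e0.
pose r := Num.min 1 (e / 2).
have r0 : 0 < r by rewrite lt_min ltr01 divr_gt0.
have r2 : r ^+ 2 <= e / 2.
  have r1 : r <= 1 by rewrite ge_min lexx.
  have re : r <= e / 2 by rewrite ge_min lexx orbT.
  by rewrite expr2; nra.
have [m1 h1] := ha _ r0; have [m2 h2] := hb _ r0.
exists (maxn m1 m2) => p; rewrite geq_max => /andP[/h1 k1 /h2 k2].
rewrite /sqmod !raddfB /=.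
have sq (x : R) : `|x| < r -> x ^+ 2 < r ^+ 2.
  by move=> h; rewrite -[x ^+ 2]real_normK ?num_real // ltr_pXn2r ?nnegrE // ltW.
by have := sq _ k1; have := sq _ k2; lra.
Qed.

End Complete.

Section DotForm.
Context (R : realType) (V : lmodType R[i]) (ip : {dot V for Num.Def.conjC}).

Definition reform (x y : V) : R := complex.Re (ip x y).
Local Notation n x := (reform x x).

Lemma dotZl (c : R[i]) x y : ip (c *: x) y = c * ip x y.
Proof. exact: linearZl_LR. Qed.

Lemma dotC x y : ip x y = conjc (ip y x).
Proof. by rewrite hermC expr0 mul1r. Qed.

Lemma reform_realform : realform reform.
Proof.
split.
- by move=> x y; rewrite /reform dotC; case: (ip y x).
- by move=> x y z; rewrite /reform linearDl raddfD.
- move=> a x y; rewrite /reform dotZl; case: (ip x y) => u v /=; ring.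
- move=> x y; rewrite /reform dotZl dotC dotZl (dotC y); case: (ip x y) => u v /=; ring.
- by move=> x; have := dnorm_ge0 ip x; rewrite lecE => /andP[].
Qed.

Lemma dot_selfE x : ip x x = (n x)%:C.
Proof.
have := dnorm_ge0 ip x; rewrite /reform lecE; case: (ip x x) => a b /= /andP[/eqP-> _].
by [].
Qed.

Lemma reform_def x : n x = 0 -> x = 0.
Proof.
by move=> h; apply/eqP; rewrite -(dnorm_eq0 ip) dot_selfE h.
Qed.

Lemma reform_CS x y : reform x y ^+ 2 <= n x * n y.
Proof.
have rg := reform_realform.
have [/reform_def->|/eqP ny] := pselect (n y = 0).
  have z0 z : reform 0 z = 0.
    by have := rformZ rg 0 0 z; rewrite rmorph0 scale0r mul0r.
  by rewrite rformC // !z0 expr0n mulr0.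
have {}ny : 0 < n y by rewrite lt_neqAle eq_sym ny (rform_ge0 rg).
have := rform_ge0 rg ((n y)%:C *: x - (reform x y)%:C *: y).
rewrite !(rformD rg) !(rformN rg) !(rformZ rg).
rewrite !(rformDr rg) !(rformNr rg) !(rformZr rg) (rformC rg y x) => h.
rewrite -subr_ge0 -(pmulr_rge0 _ ny); lra.
Qed.

End DotForm.

Section Gelfand.
Context (R : realType) (K : hilbertSpace R).
Local Notation g := (reform (hdot K)).
Local Notation n x := (reform (hdot K) x x).
Let rg := reform_realform (hdot K).

Lemma hnormE (x : K) : hnorm x ^+ 2 = n x.
Proof. by rewrite /hnorm /dot_norm sqr_sqrtr // (rform_ge0 rg). Qed.

Lemma opnorm_le_sq (T : K -> K) M : opnorm_le T M ->
  forall x, n (T x) <= M ^+ 2 * n x.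
Proof.
move=> hM x; rewrite -!hnormE -exprMn lerXn2r ?nnegrE ?sqrtr_ge0 //.
exact: le_trans (sqrtr_ge0 _) (hM x).
Qed.

Lemma bounded_op_stable (T : K -> K) : bounded_op T -> stable (fun x => n x) T.
Proof.
by move=> [_ [M hM]]; exists (M ^+ 2); [exact: sqr_ge0 | exact: opnorm_le_sq].
Qed.

Lemma sq_opnorm_le (T : K -> K) M : 0 <= M -> (forall x, n (T x) <= M ^+ 2 * n x) ->
  opnorm_le T M.
Proof.
move=> M0 hM x.
by rewrite -(@ler_pXn2r _ 2) ?nnegrE ?mulr_ge0 ?sqrtr_ge0 // exprMn !hnormE.
Qed.

Lemma stable_bounded_op (T : K -> K) : linear T -> stable (fun x => n x) T ->
  bounded_op T.
Proof.
move=> lT [M M0 hM]; split=> //; exists (Num.sqrt M); apply: sq_opnorm_le => //.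
  exact: sqrtr_ge0.
by move=> x; rewrite sqr_sqrtr.
Qed.

Lemma adjoint_reform (T S : K -> K) : is_adjoint T S ->
  forall x y, g (T x) y = g x (S y).
Proof. by move=> [_ h] x y; rewrite /reform h. Qed.

Lemma normal_op_pair (T : K -> K) : normal_op T -> exists S, normal_pair g T S.
Proof.
move=> [bT [S aS cS]]; exists S; split.
- exact: bT.1.
- exact: aS.1.1.
- exact: adjoint_reform.
- exact: bounded_op_stable.
- exact: bounded_op_stable aS.1.
- by move=> x; have := congr1 (fun f => f x) cS.
Qed.

End Gelfand.

(** * The character of a joint approximate eigenvector *)

Section GelfandCharacter.
Context (R : realType) (K : hilbertSpace R).
Local Notation g := (reform (hdot K)).
Local Notation n x := (reform (hdot K) x x).
Let rg := reform_realform (hdot K).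
Let nsn := rform_sqsn rg.
Let n0 := rform_ge0 rg.

Section Sequence.
Variable (x : nat -> K).
Hypothesis x_pos : forall m, 0 < n (x m).

(* c is the value at T of the character carried by the sequence x of
   approximate eigenvectors.  The second clause says that the adjoint of T
   nearly maps x m to c^* x m; it is phrased without the adjoint, whose
   existence for an arbitrary bounded operator would need Riesz's theorem. *)
Definition asym_bound (T : K -> K) (c : R[i]) (e : R) m :=
  n (T (x m) - c *: x m) <= e * n (x m) /\
  forall y, g (T y - c *: y) (x m) ^+ 2 <= e * n y * n (x m).

Definition asym (T : K -> K) (c : R[i]) := forall e : R, 0 < e ->
  exists m0 : nat, forall m, (m0 <= m)%N -> asym_bound T c e m.

Lemma asymI (C : R) T c : 0 < C -> (forall e : R, 0 < e ->
    exists m0 : nat, forall m, (m0 <= m)%N -> asym_bound T c (C * e) m) ->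
  asym T c.
Proof.
move=> C0 h e e0; have [m0 hm] := h _ (divr_gt0 e0 C0).
by exists m0 => m /hm; rewrite mulrC divfK // gt_eqF.
Qed.

Lemma sqrD_le (a b : R) : (a + b) ^+ 2 <= 2 * (a ^+ 2 + b ^+ 2).
Proof. have := sqr_ge0 (a - b); lra. Qed.

Lemma asymD S T c d : asym S c -> asym T d -> asym (S \+ T) (c + d).
Proof.
move=> hS hT; apply: (@asymI 4) => // e e0.
have [m1 h1] := hS _ e0; have [m2 h2] := hT _ e0.
exists (maxn m1 m2) => m; rewrite geq_max => /andP[/h1[a1 b1] /h2[a2 b2]].
have E y : S y + T y - (c + d) *: y = (S y - c *: y) + (T y - d *: y).
  by rewrite scalerDl opprD addrACA.
split=> [|y] /=; rewrite E.
  by have := sqsnD nsn (S (x m) - c *: x m) (T (x m) - d *: x m); lra.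
rewrite (rformD rg); apply: le_trans (sqrD_le _ _) _.
by have := b1 y; have := b2 y; lra.
Qed.

Lemma asymZ T a c : linear T -> asym T c -> asym (a \*: T) (a * c).
Proof.
move=> lT hT; apply: (@asymI (sqmod a + 1)); first by rewrite ltr_wpDl ?sqmod_ge0.
move=> e e0; have [m1 h1] := hT _ e0; exists m1 => m /h1[a1 b1].
have E y : a *: T y - (a * c) *: y = a *: (T y - c *: y).
  by rewrite scalerBr scalerA.
have sa := sqmod_ge0 a.
have le_sa (r : R) : 0 <= r -> sqmod a * (e * r) <= (sqmod a + 1) * e * r.
  by move=> r0; rewrite -mulrA ler_wpM2r ?lerDl // mulr_ge0 // ltW.
split=> [|y] /=; rewrite E.
  by rewrite (sqsnZ nsn); apply: le_trans (ler_wpM2l sa a1) (le_sa _ (n0 _)).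
(* The real form is not complex linear, so the scalar is absorbed into the test vector. *)
have -> : a *: (T y - c *: y) = T (a *: y) - c *: (a *: y).
  by rewrite (linZ lT) scalerBr !scalerA mulrC.
apply: le_trans (b1 _) _; rewrite (sqsnZ nsn).
by have := le_sa _ (mulr_ge0 (n0 y) (n0 (x m))); lra.
Qed.

Lemma asym_id : asym id 1.
Proof.
move=> e e0; exists 0%N => m _; split=> [|y]; rewrite scale1r subrr.
  have -> : n (0 : K) = 0 by rewrite -(scale0r (0 : K)) (sqsnZ nsn) sqmod_real expr0n mul0r.
  by rewrite mulr_ge0 // ltW.
have -> : g 0 (x m) = 0 by have := rformZ rg 0 0 (x m); rewrite rmorph0 scale0r mul0r.
by rewrite expr0n !mulr_ge0 // ltW.
Qed.

Lemma asymM S T c d : linear S -> linear T -> stable (fun x => n x) S ->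
  stable (fun x => n x) T -> asym S c -> asym T d -> asym (S \o T) (c * d).
Proof.
move=> lS lT [MS MS0 bS] [MT MT0 bT] hS hT.
have sc := sqmod_ge0 c; have sd := sqmod_ge0 d.
apply: (@asymI (2 * (MS + MT + sqmod c + sqmod d + 1))); first lra.
move=> e e0; have [m1 h1] := hS _ e0; have [m2 h2] := hT _ e0.
exists (maxn m1 m2) => m; rewrite geq_max => /andP[/h1[a1 b1] /h2[a2 b2]].
split=> [|y] /=.
  have -> : S (T (x m)) - (c * d) *: x m
      = S (T (x m) - d *: x m) + d *: (S (x m) - c *: x m).
    by rewrite (linB lS) (linZ lS) scalerBr scalerA (mulrC d) addrA subrK.
  apply: le_trans (sqsnD nsn _ _) _; rewrite (sqsnZ nsn).
  have k1 : n (S (T (x m) - d *: x m)) <= MS * (e * n (x m)).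
    exact: le_trans (bS _) (ler_wpM2l MS0 a2).
  have k2 := ler_wpM2l sd a1.
  have k3 : 0 <= (MT + sqmod c + 1) * (e * n (x m)).
    by apply: mulr_ge0; [lra | apply: mulr_ge0 => //; exact: ltW].
  lra.
have -> : S (T y) - (c * d) *: y
    = (S (T y) - c *: T y) + (T (c *: y) - d *: (c *: y)).
  by rewrite (linZ lT) scalerA (mulrC d) addrA subrK.
rewrite (rformD rg); apply: le_trans (sqrD_le _ _) _.
have k1 : g (S (T y) - c *: T y) (x m) ^+ 2 <= MT * (e * (n y * n (x m))).
  apply: le_trans (b1 _) _.
  have -> : MT * (e * (n y * n (x m))) = e * (MT * n y) * n (x m) by ring.
  by rewrite ler_wpM2r // ler_wpM2l // ltW.
have := b2 (c *: y); rewrite (sqsnZ nsn).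
have k3 : 0 <= (MS + sqmod d + 1) * (e * (n y * n (x m))).
  by apply: mulr_ge0; [lra | apply: mulr_ge0; [exact: ltW | exact: mulr_ge0]].
lra.
Qed.

(** The adjoint exchanges the two clauses of [asym_bound]: the second one for [T], tested at the
    defect vector of [S], gives the first for [S]; Cauchy-Schwarz turns the first for [T] into the
    second for [S]. *)
Lemma asym_adjoint S T c : is_adjoint T S -> asym T c -> asym S (conjc c).
Proof.
move=> aTS hT e e0; have [m1 h1] := hT _ e0; exists m1 => m /h1[a1 b1].
have adj y z : g (T y - c *: y) z = g y (S z - conjc c *: z).
  by rewrite (rformD rg) (rformDr rg) (rformN rg) (rformNr rg)
    (adjoint_reform aTS) (rform_conj rg).
split=> [|y].
  set v := S (x m) - _; have := b1 v; rewrite adj -/v expr2.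
  have [->|vn0] := eqVneq (n v) 0; first by rewrite mulr_ge0 // ltW.
  have v0 : 0 < n v by rewrite lt_neqAle eq_sym vn0 n0.
  by rewrite [e * _ * _]mulrAC ler_pM2r.
rewrite (rformC rg) -adj; apply: le_trans (reform_CS _ _ _) _.
have := ler_wpM2r (n0 y) a1; lra.
Qed.

(** With S = T this makes the value unique; for operators close in norm it makes the values
    close. *)
Lemma asym_sqmod_le S T c d (e : R) m :
  asym_bound S c e m -> asym_bound T d e m ->
  sqmod (c - d) * n (x m) <= 8 * (e * n (x m)) + 2 * n (S (x m) - T (x m)).
Proof.
move=> [a1 _] [a2 _]; rewrite -(sqsnZ nsn).
have -> : (c - d) *: x m
    = ((T (x m) - d *: x m) - (S (x m) - c *: x m)) + (S (x m) - T (x m)).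
  rewrite scalerBl opprB !addrA subrK addrAC [T (x m) - _]addrC addrK.
  by rewrite addrC.
apply: le_trans (sqsnD nsn _ _) _.
have := sqsnD nsn (T (x m) - d *: x m) (- (S (x m) - c *: x m)).
rewrite (rformN rg (S (x m) - _)) (rformNr rg) opprK; lra.
Qed.

Lemma asym_uniq T c d : asym T c -> asym T d -> c = d.
Proof.
move=> hc hd; apply: contrapT => /eqP ncd.
have s0 : 0 < sqmod (c - d).
  rewrite lt_neqAle sqmod_ge0 andbT eq_sym; apply: contraNneq ncd => s0.
  rewrite -subr_eq0; move: s0 => /eqP; rewrite paddr_eq0 ?sqr_ge0 // !sqrf_eq0.
  by rewrite eq_complex.
have e0 : 0 < sqmod (c - d) / 16 by rewrite divr_gt0.
have [m1 h1] := hc _ e0; have [m2 h2] := hd _ e0.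
pose m := maxn m1 m2.
have := asym_sqmod_le (h1 m (leq_maxl _ _)) (h2 m (leq_maxr _ _)).
rewrite subrr; have -> : n (0 : K) = 0.
  by rewrite -(scale0r (0 : K)) (sqsnZ nsn) sqmod_real expr0n mul0r.
have := mulr_gt0 s0 (x_pos m); lra.
Qed.

Lemma asym_closed T : bounded_op T ->
  (forall e : R, 0 < e -> exists2 S, (exists c, asym S c) & opnorm_le (T \- S) e) ->
  exists c, asym T c.
Proof.
move=> bT hT.
have ex j : exists Sc : (K -> K) * R[i], asym Sc.1 Sc.2 /\
    forall y, n (T y - Sc.1 y) <= (j.+1%:R^-1) ^+ 2 * n y.
  have [|S [c hc] hS] := hT (j.+1%:R^-1); first by rewrite invr_gt0.
  by exists (S, c); split=> // y; exact: (opnorm_le_sq hS).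
have [Sc hSc] := choice ex.
have small (e : R) : 0 < e -> exists m : nat, forall j, (m <= j)%N -> (j.+1%:R^-1) ^+ 2 <= e.
  move=> e0; exists (Num.truncn e^-1) => j hj.
  have h1 : j.+1%:R^-1 <= e.
    rewrite -[e]invrK lef_pV2 ?posrE ?invr_gt0 // ltW //.
    apply: lt_le_trans (truncnS_gt _) _.
    by rewrite ler_nat.
  have h2 : j.+1%:R^-1 <= 1 :> R by rewrite invf_le1 // ler1n.
  apply: le_trans h1; rewrite expr2 ler_piMr // invr_ge0 //.
have [|c hc] := complex_cauchy_cvg (u := fun j => (Sc j).2).
  move=> e e0; have e32 : 0 < e / 32 by rewrite divr_gt0.
  have [m hm] := small _ e32.
  exists m => p q /hm hp /hm hq.
  have [m1 h1] := (hSc p).1 _ e32.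
  have [m2 h2] := (hSc q).1 _ e32.
  (* The index of the eigenvector depends on [p] and [q], but the bound it yields on the difference
     of the values does not. *)
  pose k := maxn m1 m2.
  rewrite -(ltr_pM2r (x_pos k)).
  apply: le_lt_trans (asym_sqmod_le (h1 k (leq_maxl _ _)) (h2 k (leq_maxr _ _))) _.
  have kp := le_trans ((hSc p).2 (x k)) (ler_wpM2r (n0 (x k)) hp).
  have kq := le_trans ((hSc q).2 (x k)) (ler_wpM2r (n0 (x k)) hq).
  have -> : (Sc p).1 (x k) - (Sc q).1 (x k)
      = (T (x k) - (Sc q).1 (x k)) + - (T (x k) - (Sc p).1 (x k)).
    by rewrite opprB [RHS]addrC addrA subrK.
  have := sqsnD nsn (T (x k) - (Sc q).1 (x k)) (- (T (x k) - (Sc p).1 (x k))).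
  rewrite (rformN rg (T (x k) - (Sc p).1 (x k))) (rformNr rg) opprK.
  move: kp kq (mulr_gt0 e0 (x_pos k)); clear; lra.
exists c; apply: (@asymI 12) => // e e0.
have [ma ha] := small _ e0; have [mb hb] := hc _ e0.
pose j := maxn ma mb.
have [m0 h0] := (hSc j).1 _ e0.
have {}ha := ha j (leq_maxl _ _); have {}hb := ltW (hb j (leq_maxr _ _)).
have hST y : n (T y - (Sc j).1 y) <= e * n y.
  exact: le_trans ((hSc j).2 y) (ler_wpM2r (n0 y) ha).
exists m0 => m /h0[a1 b1].
set S := (Sc j).1 in a1 b1 hST; set d := (Sc j).2 in a1 b1 hb.
have E y : T y - c *: y = (T y - S y) + ((S y - d *: y) + (d - c) *: y).
  by rewrite scalerBl !addrA !subrK.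
have hdc y : n ((d - c) *: y) <= e * n y by rewrite (sqsnZ nsn) ler_wpM2r.
split=> [|y]; rewrite E.
  apply: le_trans (sqsnD nsn _ _) _.
  have := sqsnD nsn (S (x m) - d *: x m) ((d - c) *: x m).
  have := hST (x m); have := hdc (x m); have := mulr_gt0 e0 (x_pos m); lra.
rewrite !(rformD rg (_ - _)).
have CS z : n z <= e * n y -> g z (x m) ^+ 2 <= e * n y * n (x m).
  by move=> hz; apply: le_trans (reform_CS _ _ _) _; rewrite ler_wpM2r.
have := b1 y; have := CS _ (hST y); have := CS _ (hdc y).
move: (g (T y - S y) _) (g ((d - c) *: y) _) (g (S y - _) _) => u v w.
have : 0 <= e * n y * n (x m) by rewrite !mulr_ge0 // ltW.
move=> h1 h2 h3 h4; apply: le_trans (sqrD_le _ _) _.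
have := sqrD_le w v; lra.
Qed.

End Sequence.

(** The bounded operators with an asymptotic value along a sequence of joint approximate
    eigenvectors form a unital C*-subalgebra containing every [N k], hence the generated one. The
    value is the character. *)
Lemma approx_joint_eigenvalue_gelfand d (N : 'I_d -> K -> K) (lam : 'I_d -> R[i]) :
  (forall k, normal_op (N k)) ->
  (forall e : R, 0 < e -> exists x,
     \sum_(k < d) n (N k x - lam k *: x) < e * n x) ->
  gelfand_spectrum N (\row_k lam k).
Proof.
move=> nN h.
have ex m : exists x, \sum_(k < d) n (N k x - lam k *: x) < m.+1%:R^-1 * n x.
  by apply: h; rewrite invr_gt0.
have [x hx] := choice ex.
have x_pos m : 0 < n (x m).
  have := le_lt_trans (sumr_ge0 _ (fun k _ => n0 _)) (hx m).
  by rewrite pmulr_rgt0 // invr_gt0.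
have asymN k : asym x (N k) (lam k).
  have [S np] := normal_op_pair (nN k).
  move=> e e0; exists (Num.truncn e^-1) => m hm.
  have hk : n (N k (x m) - lam k *: x m) <= e * n (x m).
    apply: le_trans (_ : m.+1%:R^-1 * n (x m) <= _); last first.
      rewrite ler_wpM2r // -[e]invrK lef_pV2 ?posrE ?invr_gt0 // ltW //.
      by apply: lt_le_trans (truncnS_gt _) _; rewrite ler_nat.
    apply: le_trans (ltW (hx m)).
    rewrite (bigD1 k) //= lerDl; apply: sumr_ge0 => *; exact: n0.
  (* By normality the adjoint has a defect of the same norm, so the second clause follows from the
     first. *)
  split=> // y; have npk := normal_pair_shift rg (lam k) np.
  rewrite (np_adj npk); apply: le_trans (reform_CS _ _ _) _.
  rewrite -(normal_pair_norm rg npk).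
  have := ler_wpM2l (n0 y) hk; lra.
pose X : set (K -> K) := [set T | bounded_op T /\ exists c, asym x T c].
have XP : unital_cstar_subalgebra X.
  split.
  - by move=> T [].
  - split; last by exists 1; exact: asym_id.
    by apply: stable_bounded_op => //; exact: stable_id.
  - move=> S T [bS [c hc]] [bT [c' hc']]; split; last first.
      by exists (c + c'); exact: asymD.
    apply: stable_bounded_op; last first.
      by apply: stableD => //; exact: bounded_op_stable.
    by move=> a y z /=; rewrite bS.1 bT.1 scalerDr addrACA.
  - move=> a T [bT [c hc]]; split; last first.
      by exists (a * c); apply: asymZ => //; exact: bT.1.
    apply: stable_bounded_op; last first.
      by apply: stableZ => //; exact: bounded_op_stable.
    by move=> b y z /=; rewrite bT.1 scalerDr !scalerA mulrC.
  - move=> S T [bS [c hc]] [bT [c' hc']]; split; last first.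
      exists (c * c'); apply: asymM => //; try exact: bounded_op_stable.
        exact: bS.1.
      exact: bT.1.
    apply: stable_bounded_op; last first.
      by apply: stable_comp; exact: bounded_op_stable.
    by move=> a y z /=; rewrite bT.1 bS.1.
  - move=> S T [bT [c hc]] aTS; split; first exact: aTS.1.
    by exists (conjc c); exact: asym_adjoint aTS hc.
  - move=> T bT hT; split=> //; apply: asym_closed => // e /hT[S [_ XS] le].
    by exists S.
have XN k : X (N k) by split; [exact: (nN k).1 | exists (lam k)].
(* The default 0 occurs only where no value exists, hence outside [X]. *)
pose pi (T : K -> K) : R[i] := xget 0 [set c | asym x T c].
have piE T c : asym x T c -> pi T = c.
  move=> hc; apply: (asym_uniq x_pos) (hc).
  by apply: (@xgetPex _ 0 [set c | asym x T c]); exists c.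
exists pi; last by apply/rowP => k; rewrite !mxE (piE _ _ (asymN k)).
have sub T : cstar_generated N T -> X T by move=> /(_ X XP XN).
split.
- by apply: piE; exact: asym_id.
- move=> S T /sub[_ [c hc]] /sub[_ [c' hc']].
  by rewrite (piE _ _ hc) (piE _ _ hc'); apply: piE; exact: asymD.
- move=> a T /sub[bT [c hc]].
  by rewrite (piE _ _ hc); apply: piE; apply: asymZ => //; exact: bT.1.
- move=> S T /sub[bS [c hc]] /sub[bT [c' hc']].
  rewrite (piE _ _ hc) (piE _ _ hc'); apply: piE.
  apply: asymM => //; [exact: bS.1|exact: bT.1|exact: bounded_op_stable..].
Qed.

End GelfandCharacter.

(** * Positivity of Toeplitz forms *)

Section Toeplitz.
Local Arguments conjc : simpl never.
Context (R : realType).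

Lemma conjcD : {morph (@conjc R) : x y / x + y}.
Proof. by move=> [a b] [c e]; rewrite /conjc /= opprD. Qed.

Lemma conjcM : {morph (@conjc R) : x y / x * y}.
Proof.
move=> [a b] [c e]; apply/eqP; rewrite eq_complex /=.
by apply/andP; split; apply/eqP; rewrite /=; ring.
Qed.

Lemma conjcX k : {morph (@conjc R) : x / x ^+ k}.
Proof.
by move=> x; elim: k => [|k IH]; rewrite ?expr0 ?conjc1 // !exprS conjcM IH.
Qed.

Lemma conjc_sum (I : finType) (P : pred I) (f : I -> R[i]) :
  conjc (\sum_(i | P i) f i) = \sum_(i | P i) conjc (f i).
Proof. exact: (big_morph _ conjcD (conjc0 R)). Qed.

(** The carrier is arbitrary so that scalars, matrices and operators share one pattern. The
    predecessors match tuples indexed from 0. *)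
Definition toep (T : Type) (D : T) (lo up : nat -> T) (i j : nat) : T :=
  if i == j then D else if (j < i)%N then lo (i - j).-1 else up (j - i).-1.

(** On the unit circle z^i conj(z)^j depends only on i - j, so each point of the curve gives a
    positive Toeplitz matrix of rank one. *)
Lemma conv_toep m (t : 'I_m -> R) (z : 'I_m -> R[i]) (i j : nat) :
  \sum_l t l = 1 -> (forall l, `|z l| = 1) ->
  toep 1 (fun k => \sum_l (t l)%:C * z l ^+ k.+1)
         (fun k => conjc (\sum_l (t l)%:C * z l ^+ k.+1)) i j
  = \sum_l (t l)%:C * (z l ^+ i * conjc (z l) ^+ j).
Proof.
move=> t1 z1.
have zz l : z l * conjc (z l) = 1.
  by rewrite -[conjc _]/((z l)^*)%C -normCK z1 expr1n.
rewrite /toep; case: (ltngtP j i) => [ji|ij|->] /=.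
- apply: eq_bigr => l _; rewrite prednK ?subn_gt0 //.
  by rewrite -{2}(subnK (ltnW ji)) exprD -mulrA -exprMn zz expr1n mulr1.
- rewrite conjc_sum; apply: eq_bigr => l _.
  rewrite conjcM conjc_real conjcX prednK ?subn_gt0 //.
  by rewrite -{2}(subnKC (ltnW ij)) exprD [z l ^+ i * _]mulrA -exprMn zz expr1n mul1r.
- rewrite -[1](rmorph1 (real_complex R)) -t1 rmorph_sum; apply: eq_bigr => l _.
  by rewrite -exprMn zz expr1n mulr1.
Qed.

Section ConvForm.
Context (V : lmodType R[i]) (g : V -> V -> R) (rg : realform g).

Lemma rform_suml (I : finType) (P : pred I) (f : I -> V) y :
  g (\sum_(i | P i) f i) y = \sum_(i | P i) g (f i) y.
Proof.
apply: (big_morph (g^~ y)) => [u v|]; first by rewrite rformD.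
by have := rformZ rg 0 0 y; rewrite rmorph0 scale0r mul0r.
Qed.

Lemma rform_sumr (I : finType) (P : pred I) (f : I -> V) y :
  g y (\sum_(i | P i) f i) = \sum_(i | P i) g y (f i).
Proof.
by rewrite (rformC rg) rform_suml; apply: eq_bigr => i _; rewrite rformC.
Qed.

(** The form is the sum over l of t_l times the squared norm of sum_j conj(z_l)^j x_j. Vectors [x i]
    are allowed in order to treat the components of an eigenvector in a direct sum; dimension 1
    covers scalar matrices. *)
Lemma conv_toep_ge0 d (p : 'rV[R[i]]_d) (c : nat -> R[i]) (x : 'I_d.+1 -> V) :
  conv_hull (moment_circle R d) p -> (forall k : 'I_d, c k = p 0 k) ->
  0 <= \sum_(i < d.+1) \sum_(j < d.+1) g (toep 1 c (fun k => conjc (c k)) i j *: x j) (x i).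
Proof.
move=> [m [t [q [t0 t1 qm ->]]]] cp.
have ex l : exists z : R[i], `|z| = 1 /\ q l = \row_(k < d) z ^+ k.+1.
  by have [z] := qm l; exists z.
have [z hz] := choice ex.
have z1 l := (hz l).1; have qz l := (hz l).2.
have E (i j : 'I_d.+1) : toep 1 c (fun k => conjc (c k)) i j
    = \sum_l (t l)%:C * (z l ^+ i * conjc (z l) ^+ j).
  rewrite -(conv_toep i j t1 z1) /toep.
  have ck k : (k < d)%N -> c k = \sum_l (t l)%:C * z l ^+ k.+1.
    move=> kd; rewrite (cp (Ordinal kd)) summxE; apply: eq_bigr => l _.
    by rewrite qz !mxE.
  have lt_pred (a b : 'I_d.+1) : (b < a)%N -> ((a - b).-1 < d)%N.
    move=> ba; have := ltn_ord a; rewrite ltnS => ad.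
    by rewrite prednK ?subn_gt0 // (leq_trans (leq_subr _ _)).
  by case: ltngtP => //= [ij|ji]; rewrite ck // lt_pred.
have -> : \sum_(i < d.+1) \sum_(j < d.+1) g (toep 1 c (fun k => conjc (c k)) i j *: x j) (x i)
    = \sum_l t l * g (\sum_(j < d.+1) conjc (z l) ^+ j *: x j)
                      (\sum_(j < d.+1) conjc (z l) ^+ j *: x j).
  under eq_bigr do under eq_bigr do rewrite E scaler_suml rform_suml.
  under eq_bigr do rewrite exchange_big.
  rewrite exchange_big; apply: eq_bigr => l _.
  rewrite rform_sumr mulr_sumr; apply: eq_bigr => i _.
  rewrite rform_suml mulr_sumr; apply: eq_bigr => j _.
  rewrite -scalerA (rformZ rg) -scalerA (rform_conj rg); congr (_ * g _ (_ *: _)).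
  exact: conjcX.
by apply: sumr_ge0 => l _; rewrite mulr_ge0 // (rform_ge0 rg).
Qed.

End ConvForm.
End Toeplitz.

(** * Operator matrices on a finite direct sum *)

Section OperatorMatrix.
Context (R : realType) (V : lmodType R[i]) (g : V -> V -> R) (rg : realform g).
Context (m : nat).
Local Notation n x := (g x x).
Local Notation W := {ffun 'I_m -> V}.

Definition ffform (h k : W) : R := \sum_i g (h i) (k i).

Lemma ffform_realform : realform ffform.
Proof.
split.
- by move=> x y; apply: eq_bigr => i _; exact: rformC.
- move=> x y z; rewrite /ffform -big_split; apply: eq_bigr => i _.
  by rewrite ffunE rformD.
- move=> a x y; rewrite /ffform mulr_sumr; apply: eq_bigr => i _.
  by rewrite ffunE rformZ.
- by move=> x y; apply: eq_bigr => i _; rewrite !ffunE rformI.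
- by move=> x; apply: sumr_ge0 => i _; exact: rform_ge0.
Qed.

Definition opmx (T : 'I_m -> 'I_m -> V -> V) (h : W) : W :=
  [ffun i => \sum_j T i j (h j)].

Definition opdiag (T : V -> V) (h : W) : W := [ffun i => T (h i)].

Lemma opmx_linear T : (forall i j, linear (T i j)) -> linear (opmx T).
Proof.
move=> lT a x y; apply/ffunP => i; rewrite !ffunE scaler_sumr -big_split.
by apply: eq_bigr => j _; rewrite !ffunE lT.
Qed.

Lemma opmx_stable T : (forall i j, stable (fun x => n x) (T i j)) ->
  stable (fun h => ffform h h) (opmx T).
Proof.
move=> bT; have nsn := rform_sqsn rg; have n0 := rform_ge0 rg.
have ex (ij : 'I_m * 'I_m) : exists M : R, 0 <= M /\
    forall x, n (T ij.1 ij.2 x) <= M * n x.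
  by have [M M0 hM] := bT ij.1 ij.2; exists M.
have [M hM] := choice ex.
pose S := \sum_ij M ij.
have MS ij : M ij <= S.
  rewrite /S (bigD1 ij) //= lerDl; apply: sumr_ge0 => k _; exact: (hM k).1.
have S0 : 0 <= S by apply: sumr_ge0 => k _; exact: (hM k).1.
exists (\sum_(i < m) 2 ^+ m * S).
  by apply: sumr_ge0 => i _; rewrite mulr_ge0 // exprn_ge0.
move=> h; rewrite {1}/ffform mulr_suml; apply: ler_sum => i _.
rewrite ffunE; apply: le_trans (sqsn_sum nsn _) _.
rewrite -mulrA ler_wpM2l ?exprn_ge0 //.
rewrite /ffform mulr_sumr; apply: ler_sum => j _.
by apply: le_trans ((hM (i, j)).2 _) _; rewrite ler_wpM2r.
Qed.

Lemma opmx_adj T T' : (forall i j x y, g (T i j x) y = g x (T' j i y)) ->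
  forall h k, ffform (opmx T h) k = ffform h (opmx T' k).
Proof.
move=> aT h k; rewrite /ffform.
under eq_bigr do rewrite ffunE (rform_suml rg).
rewrite exchange_big; apply: eq_bigr => j _.
by rewrite ffunE (rform_sumr rg); apply: eq_bigr => i _; rewrite aT.
Qed.

Lemma opdiag_pair T S : normal_pair g T S -> normal_pair ffform (opdiag T) (opdiag S).
Proof.
move=> [lT lS aTS [M M0 bT] [M' M0' bS] cTS].
split.
- by move=> a x y; apply/ffunP => i; rewrite !ffunE lT.
- by move=> a x y; apply/ffunP => i; rewrite !ffunE lS.
- by move=> x y; apply: eq_bigr => i _; rewrite !ffunE.
- exists M => // x; rewrite /ffform mulr_sumr; apply: ler_sum => i _.
  by rewrite ffunE.
- exists M' => // x; rewrite /ffform mulr_sumr; apply: ler_sum => i _.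
  by rewrite ffunE.
- by move=> x; apply/ffunP => i; rewrite !ffunE.
Qed.

Lemma opmx_diagC T S : linear S -> (forall i j x, T i j (S x) = S (T i j x)) ->
  forall h, opmx T (opdiag S h) = opdiag S (opmx T h).
Proof.
move=> lS cTS h; apply/ffunP => i; rewrite !ffunE (lin_sum lS).
by apply: eq_bigr => j _; rewrite ffunE.
Qed.

End OperatorMatrix.

(** * The operator Toeplitz matrix of commuting normal operators *)

Section SpectralToeplitz.
Context (R : realType) (V : lmodType R[i]) (g : V -> V -> R) (rg : realform g).
Local Notation n x := (g x x).
Hypothesis g_def : forall x, n x = 0 -> x = 0.
Context (d : nat) (N N' : nat -> V -> V).
Hypothesis np : forall k, normal_pair g (N k) (N' k).
Hypothesis cN : forall j k x, N j (N k x) = N k (N j x).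
Hypothesis spec : forall c : nat -> R[i],
  (forall e : R, 0 < e -> exists x, \sum_(k < d) n (N k x - c k *: x) < e * n x) ->
  conv_hull (moment_circle R d) (\row_(k < d) c k).

Lemma toep_op_ge0 (h : 'I_d.+1 -> V) :
  0 <= \sum_(i < d.+1) \sum_(j < d.+1) g (toep id N N' i j (h j)) (h i).
Proof.
pose W := {ffun 'I_d.+1 -> V}; pose gW := @ffform R V g d.+1.
have rW : realform gW by exact: ffform_realform.
have nW := rform_sqsn rW; have n0 := rform_ge0 rg; have nW0 := rform_ge0 rW.
have cNN' j k x : N j (N' k x) = N' k (N j x).
  by apply: (fuglede rg g_def (np j) (np k)) => y; exact: cN.
have cN'N' j k x : N' j (N' k x) = N' k (N' j x).
  by apply: (rform_inj rg g_def) => z; rewrite !(np_adj' rg (np _)) cN.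
pose T (i j : 'I_d.+1) := toep id N N' i j.
have lT i j : linear (T i j).
  rewrite /T /toep; case: ifP => _; first by move=> a x y.
  by case: ifP => _; [exact: np_lin (np _) | exact: np_lin' (np _)].
have aT i j x y : g (T i j x) y = g x (T j i y).
  rewrite /T /toep; case: (ltngtP j i) => // ij; first exact: np_adj (np _) _ _.
  exact: (np_adj' rg (np _)).
have bT i j : stable (fun x => n x) (T i j).
  rewrite /T /toep; case: ifP => _; first exact: stable_id.
  by case: ifP => _; [exact: np_bd (np _) | exact: np_bd' (np _)].
pose M := opmx T.
pose q (x : W) := gW (M x) x.
suff q0 x : 0 <= q x.
  have := q0 [ffun i => h i]; congr (0 <= _).
  rewrite /q /gW /ffform; apply: eq_bigr => i _; rewrite !ffunE (rform_suml rg).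
  by apply: eq_bigr => j _; rewrite ffunE.
rewrite leNgt; apply/negP => qx.
have lM : linear M by exact: opmx_linear.
(* [selfadjoint_step] finds eigenvalues from above, hence the sign: a positive [a] for [A] is a
   negative approximate eigenvalue of [M]. *)
pose A (x : W) := - M x.
have lA : linear A by move=> a y z; rewrite /A lM opprD scalerN.
have aA y z : gW (A y) z = gW y (A z).
  by rewrite (rformN rW) (rformNr rW) (opmx_adj rg aT y z : gW (M y) z = gW y (M z)).
have bA : stable (fun y => gW y y) A.
  have [C C0 hC] := opmx_stable rg bT; exists C => // y.
  by rewrite (rformN rW) (rformNr rW) opprK; exact: hC.
have nx : 0 < gW x x.
  rewrite lt_neqAle nW0 andbT; apply: contraTneq qx => /esym nx0.
  rewrite -leNgt /q /gW /ffform sumr_ge0 // => i _.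
  have /eqP : \sum_i n (x i) = 0 by exact: nx0.
  rewrite psumr_eq0 // => /allP/(_ i); rewrite mem_index_enum => /(_ isT)/eqP/g_def ->.
  by rewrite -(scale0r (0 : V)) (rformZr rg 0) mul0r.
have [||a a0 ha] := selfadjoint_step rW (t0 := gW (A x) x / gW x x) (@sqsn0 R W) lA aA bA.
- by exists 0 => // y; rewrite mul0r.
- by move=> e e0; exists x; rewrite divfK ?gt_eqF //; split=> //; exact: mulr_gt0.
have {}a0 : 0 < a.
  apply: lt_le_trans a0; apply: divr_gt0 => //.
  by rewrite (rformN rW) oppr_gt0.
pose Q (y : W) := gW (A y - a%:C *: y) (A y - a%:C *: y).
have {}ha : approx_null Q gW.
  by apply: (approx_null_le ltr01) ha => y; rewrite mul1r add0r.
pose D k : W -> W := opdiag (N k); pose D' k : W -> W := opdiag (N' k).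
have npD k : normal_pair gW (D k) (D' k) by exact: opdiag_pair.
have [cTN cTN'] : (forall i j k y, T i j (N k y) = N k (T i j y)) /\
                  (forall i j k y, T i j (N' k y) = N' k (T i j y)).
  split=> i j k y; rewrite /T /toep; case: ifP => // _; case: ifP => _ //.
have QD k : stable Q (D k).
  apply: (stable_shift _ (np_lin (npD k))) (np_bd (npD k)) => y.
  by rewrite /A /M (opmx_diagC (np_lin (np k))) // (linN (np_lin (npD k))).
have QD' k : stable Q (D' k).
  apply: (stable_shift _ (np_lin' (npD k))) (np_bd' (npD k)) => y.
  by rewrite /A /M (opmx_diagC (np_lin' (np k))) // (linN (np_lin' (npD k))).
have [||c hc] := joint_approx_eigenvalue rW npD _ _ (sqsn_shift rW _ lA) QD QD' ha d.
- by move=> j k y; apply/ffunP => i; rewrite !ffunE cN.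
- by move=> j k y; apply/ffunP => i; rewrite !ffunE cNN'.
have conv_c : conv_hull (moment_circle R d) (\row_(k < d) c k).
  apply: spec => e /hc[y hy].
  have : \sum_(k < d) gW (D k y - c k *: y) (D k y - c k *: y) < e * gW y y.
    by apply: le_lt_trans hy; rewrite lerDr; exact: nW0.
  rewrite /gW /ffform exchange_big mulr_sumr => {}hy.
  (* Some component of [y] is as good an eigenvector as [y] itself: otherwise the reverse
     inequalities would add up over the components. *)
  apply: contrapT => /forallNP no; move: hy; apply/negP; rewrite -leNgt.
  apply: ler_sum => i _; have /negP := no (y i); rewrite -leNgt => /le_trans; apply.
  by apply: ler_sum => k _; rewrite !ffunE.
pose mm : R := \sum_(i < d.+1) \sum_(j < d.+1) 1.
have mm0 : 0 <= mm by do 2!(apply: sumr_ge0 => ? _); exact: ler01.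
(* [mm] counts the matrix entries. Each one causes an error of at most [s * gW y y], and the
   equation of [A] one more; together they reach only half of [a * gW y y]. *)
pose s := a / (2 * (mm + 1)).
have s0 : 0 < s by apply: divr_gt0 => //; lra.
have sE : (mm + 1) * s = a / 2 by rewrite /s; field; rewrite gt_eqF //; lra.
have s20 : 0 < s ^+ 2 by rewrite exprn_gt0.
have [y hy] := hc _ s20.
have sum0 : 0 <= \sum_(k < d) gW (D k y - c k *: y) (D k y - c k *: y).
  by apply: sumr_ge0 => k _; exact: nW0.
have ny : 0 < gW y y.
  by have := le_lt_trans (addr_ge0 (nW0 _) sum0) hy; rewrite pmulr_rgt0.
have small k j : (k < d)%N -> n (N k (y j) - c k *: y j) <= s ^+ 2 * gW y y.
  move=> kd; apply: le_trans (ltW hy); apply: ler_wpDl; first exact: nW0.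
  rewrite (bigD1 (Ordinal kd)) //=; apply: ler_wpDr.
    by apply: sumr_ge0 => l _; exact: nW0.
  rewrite /gW /ffform (bigD1 j) //= !ffunE; apply: ler_wpDr => //.
  by apply: sumr_ge0 => l _; exact: n0.
have le_ny i : n (y i) <= gW y y.
  by rewrite /gW /ffform (bigD1 i) //= lerDl; apply: sumr_ge0 => l _; exact: n0.
have amgm z (u : V) : n z <= s ^+ 2 * gW y y -> n u <= gW y y ->
    - (s * gW y y) <= g z u.
  move=> hz hu; have si : 0 < s^-1 by rewrite invr_gt0.
  have := rform_amgm rg (- z) u si; rewrite invrK !(rformN rg) (rformNr rg) opprK.
  have : s^-1 * n z <= s * gW y y.
    by rewrite -(ler_pM2l s0) mulrA mulfV ?gt_eqF // mul1r mulrA -expr2.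
  have : s * n u <= s * gW y y by rewrite ler_pM2l.
  lra.
have cy := conv_toep_ge0 rg y conv_c (c := c) (fun k => esym (mxE _ _ _ _)).
have key : - (mm * (s * gW y y)) <= q y.
  rewrite /q /gW /ffform /mm mulr_suml -sumrN -[leLHS]addr0.
  apply: le_trans (lerD (lexx _) cy) _; rewrite -big_split.
  apply: ler_sum => i _; rewrite ffunE (rform_suml rg) mulr_suml -sumrN -big_split.
  apply: ler_sum => j _; rewrite mul1r -lerBrDr -(rformN rg) -(rformD rg).
  apply: amgm (le_ny i); rewrite /T /toep.
  have ltd (u v : 'I_d.+1) : (v < u)%N -> ((u - v).-1 < d)%N.
    move=> vu; have := ltn_ord u; rewrite ltnS => ud.
    by rewrite prednK ?subn_gt0 // (leq_trans (leq_subr _ _)).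
  case: (ltngtP j i) => ij /=; first by apply: small; exact: ltd.
    rewrite -(normal_pair_norm rg (normal_pair_shift rg (c _) (np _))).
    by apply: small; exact: ltd.
  rewrite scale1r subrr; have -> : n (0 : V) = 0.
    by rewrite -(scale0r (0 : V)) (rformZr rg 0) mul0r.
  by rewrite mulr_ge0 // ltW.
have si : 0 < s^-1 by rewrite invr_gt0.
have := rform_amgm rW (- (A y - a%:C *: y)) y si.
rewrite invrK !(rformN rW (A y - _)) (rformNr rW) opprK.
rewrite (rformD rW (A y)) (rformN rW (a%:C *: y)) (rformZ rW) (rformN rW (M y)).
have : s^-1 * Q y <= s * gW y y.
  rewrite -(ler_pM2l s0) mulrA mulfV ?gt_eqF // mul1r mulrA -expr2.
  by apply: le_trans (ltW hy); rewrite lerDl.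
rewrite -/(q y) -/(Q y).
have : (mm + 1) * s * gW y y = a / 2 * gW y y by rewrite sE.
have := mulr_gt0 a0 ny.
move: key; clear; lra.
Qed.

End SpectralToeplitz.

(** * Unitary matrices *)

Section Unitary.
Local Open Scope sesquilinear_scope.
Context (C : numClosedFieldType).

Lemma adjmxM m n p (A : 'M[C]_(m, n)) (B : 'M[C]_(n, p)) :
  (A *m B)^t* = B^t* *m A^t*.
Proof. by rewrite trmx_mul map_mxM. Qed.

Lemma mulmx_adj_eq0 m n (A : 'M[C]_(m, n)) : A *m A^t* = 0 -> A = 0.
Proof.
move=> AA; apply/matrixP => i j; rewrite mxE.
have /matrixP/(_ i i) := AA; rewrite !mxE => /eqP.
rewrite psumr_eq0 => [|k _]; last by rewrite !mxE mul_conjC_ge0.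
move=> /allP/(_ j); rewrite mem_index_enum => /(_ isT).
by rewrite !mxE mul_conjC_eq0 => /eqP.
Qed.

Lemma psd_gram n (M : 'M[C]_n) : M = M^t* ->
  (forall x : 'cV_n, 0 <= (x^t* *m M *m x) 0 0) -> exists Y : 'M_n, M = Y *m Y^t*.
Proof.
move=> hM pM; have nM : M \is normalmx by apply/normalmxP; rewrite -hM.
set P := spectralmx M; set D := spectral_diag M.
have uP : P \is unitarymx by exact: spectral_unitarymx.
have ME : M = P^t* *m diag_mx D *m P.
  by rewrite -invmx_unitary //; exact/orthomx_spectralP.
have D0 i : 0 <= D 0 i.
  have := pM (P^t* *m delta_mx i 0).
  rewrite adjmxM trmxCK {1}ME !mulmxA.
  rewrite -[_ *m P *m P^t*]mulmxA (unitarymxP uP) mulmx1.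
  rewrite -[_ *m P *m P^t*]mulmxA (unitarymxP uP) mulmx1.
  have -> : (delta_mx i 0 : 'cV[C]_n)^t* = delta_mx 0 i.
    by rewrite trmx_delta map_delta_mx.
  by rewrite -rowE -colE !mxE eqxx mulr1n.
exists (P^t* *m diag_mx (\row_i sqrtC (D 0 i))).
have hS : (diag_mx (\row_i sqrtC (D 0 i)))^t* = diag_mx (\row_i sqrtC (D 0 i)).
  rewrite tr_diag_mx map_diag_mx; congr diag_mx; apply/rowP => i; rewrite !mxE.
  by apply: conj_Creal; rewrite ger0_real // sqrtC_ge0.
rewrite adjmxM trmxCK hS mulmxA -(mulmxA (P^t*)) mulmx_diag {1}ME.
congr (_ *m diag_mx _ *m _); apply/rowP => i; rewrite !mxE -expr2.
by rewrite sqrtCK.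
Qed.

(** A rectangular [unitarymx] has orthonormal rows; a Schmidt basis of the kernel of the adjoint,
    their orthogonal complement, completes them. *)
Lemma unitary_completion r n (O : 'M[C]_(r, n)) : O \is unitarymx ->
  exists k (Q : 'M[C]_(k, n)), (r + k)%N = n /\ col_mx O Q \is unitarymx.
Proof.
move=> uO; pose W := kermx (O^t*).
have rO := mxrank_unitary uO.
exists (\rank W), (schmidt (row_base W)); split.
  by rewrite mxrank_ker mxrank_map mxrank_tr rO subnKC // -rO rank_leq_col.
have uQ := schmidt_unitarymx (row_base W) (rank_leq_col _).
have QO : schmidt (row_base W) *m O^t* = 0.
  apply/sub_kermxP.
  by rewrite (eqmx_schmidt_free (row_base_free _)) eq_row_base.
have OQ : O *m (schmidt (row_base W))^t* = 0.
  by rewrite -[O]trmxCK -adjmxM QO trmx0 map_mx0.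
apply/unitarymxP; rewrite tr_col_mx map_row_mx mul_col_row.
by rewrite (unitarymxP uO) (unitarymxP uQ) OQ QO -scalar_mx_block.
Qed.

(** Equal Gram matrices make the map from the rows of [A] to those of [B] a well defined isometry of
    row spaces. [c] expresses an orthonormal basis [O] of the first space in the rows of [A], and
    [O'] is its image; completing both to bases of the whole space extends the isometry. *)
Lemma isometry_extension p n (A B : 'M[C]_(p, n)) :
  A *m A^t* = B *m B^t* -> exists2 U : 'M[C]_n, U \is unitarymx & B = A *m U.
Proof.
move=> AB; pose O := schmidt (row_base A).
have uO : O \is unitarymx by apply: schmidt_unitarymx; exact: rank_leq_col.
have OA : (O :=: A)%MS.
  exact: eqmx_trans (eqmx_schmidt_free (row_base_free A)) (eq_row_base A).
have OE : (O *m pinvmx A) *m A = O by rewrite mulmxKpV // OA.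
have AE : A = A *m O^t* *m O.
  have /submxP[D AD] : (A <= O)%MS by rewrite OA.
  by rewrite [X in _ = X *m _ *m _]AD mulmxtVK.
pose c := O *m pinvmx A; pose O' := c *m B.
have uO' : O' \is unitarymx.
  apply/unitarymxP; rewrite adjmxM mulmxA -[c *m B *m _]mulmxA -AB mulmxA.
  by rewrite OE -mulmxA -adjmxM OE; apply/unitarymxP.
have BE : B = A *m O^t* *m O'.
  apply/eqP; rewrite -subr_eq0; apply/eqP.
  have -> : B - A *m O^t* *m O' = (1%:M - A *m O^t* *m c) *m B.
    by rewrite mulmxBl mul1mx /O' !mulmxA.
  (* [B] enters the Gram matrix of the difference only through B B^*, which may be replaced by A
     A^*; with [A] the factor vanishes. *)
  apply: mulmx_adj_eq0; rewrite adjmxM mulmxA -[_ *m B *m _]mulmxA -AB mulmxA.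
  by rewrite mulmxBl mul1mx -[_ *m c *m A]mulmxA OE -AE subrr !mul0mx.
have [k [Q [rk uQ]]] := unitary_completion uO.
have [k' [Q' [rk' uQ']]] := unitary_completion uO'.
have kk : k' = k by apply/eqP; rewrite -(eqn_add2l (\rank A)) rk rk'.
case: _ / kk in Q rk uQ *.
exists ((col_mx O Q)^t* *m col_mx O' Q').
  apply/unitarymxP; rewrite adjmxM trmxCK mulmxA mulmxtVK //.
  by rewrite -[X in X = _]mul1mx mulmxA mulmxKtV.
have OQ : O *m (col_mx O Q)^t* = row_mx 1%:M 0.
  have := unitarymxP uQ; rewrite tr_col_mx map_row_mx mul_col_row scalar_mx_block.
  move=> /eq_block_mx[e1 e2 _ _].
  by rewrite mul_mx_row e1 e2.
by rewrite [X in _ = X *m _]AE -mulmxA [O *m _]mulmxA OQ mul_row_col mul1mx mul0mx addr0 -BE.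
Qed.

Lemma unitary_diagonalization n (U : 'M[C]_n) : U \is unitarymx ->
  exists (P : 'M[C]_n) (D : 'rV[C]_n), [/\ P \is unitarymx,
    U = P^t* *m diag_mx D *m P & forall i, `|D 0 i| = 1].
Proof.
move=> uU; have nU : U \is normalmx.
  by apply/normalmxP; rewrite (unitarymxP uU) -[_ *m U]mul1mx mulmxA mulmxKtV.
set P := spectralmx U; set D := spectral_diag U.
have uP : P \is unitarymx by exact: spectral_unitarymx.
have UE : U = P^t* *m diag_mx D *m P.
  by rewrite -invmx_unitary //; exact/orthomx_spectralP.
exists P, D; split=> // i.
have DE : diag_mx D = P *m U *m P^t*.
  by rewrite UE !mulmxA (unitarymxP uP) mul1mx mulmxtVK.
have uD : diag_mx D \is unitarymx.
  by rewrite DE !mul_unitarymx // trmxC_unitary.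
have /matrixP/(_ i i) := unitarymxP uD.
rewrite tr_diag_mx map_diag_mx mulmx_diag !mxE eqxx mulr1n -normCK => /eqP.
by rewrite sqrp_eq1 // => /eqP.
Qed.

Lemma unitary_conj_diagX n (P : 'M[C]_n) (D : 'rV[C]_n) k : P \is unitarymx ->
  (P^t* *m diag_mx D *m P) ^+ k = P^t* *m diag_mx (\row_i (D 0 i) ^+ k) *m P.
Proof.
move=> uP; elim: k => [|k IH].
  rewrite (_ : diag_mx _ = 1%:M); last first.
    by apply/matrixP => a b; rewrite !mxE expr0.
  by rewrite mulmx1 -[P^t* *m P]mul1mx mulmxA mulmxKtV.
rewrite exprSr IH -[LHS]/(_ *m _) !mulmxA mulmxtVK // -[_ *m _ *m diag_mx D]mulmxA.
rewrite mulmx_diag; congr (_ *m diag_mx _ *m _); apply/rowP => i.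
by rewrite !mxE exprSr.
Qed.

End Unitary.

Section ToeplitzUnitary.
Local Open Scope sesquilinear_scope.
Context (C : numClosedFieldType).

Lemma adj_mxcol p (q : 'I_p -> nat) n (X : forall i, 'M[C]_(q i, n)) :
  (\mxcol_i X i)^t* = \mxrow_i (X i)^t*.
Proof. by apply/matrixP => a b; rewrite !mxE. Qed.

(** Dropping the first block row or the last one leaves the same Gram matrix, which is the
    hypothesis of [isometry_extension]. *)
Lemma toeplitz_unitary d n D (r : 'I_d.+1 -> 'M[C]_(n, D))
    (E : 'M[C]_n) (lo up : nat -> 'M[C]_n) :
  (forall i j, r i *m (r j)^t* = toep E lo up i j) ->
  exists2 U : 'M[C]_D, U \is unitarymx & forall k, r k = r ord0 *m U ^+ k.
Proof.
move=> hr.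
pose A := \mxcol_(i < d) r (widen_ord (leqnSn d) i).
pose B := \mxcol_(i < d) r (lift ord0 i).
have [|U uU BU] := @isometry_extension C _ _ A B.
  rewrite /A /B !adj_mxcol !mul_mxcol_mxrow; apply: eq_mxblock => i j.
  rewrite !hr /toep /= /bump /= !add1n.
  by rewrite eqSS ltnS !subSS.
exists U => // -[k kd]; elim: k kd => [|k IH] kd.
  by rewrite expr0 mulmx1; congr r; apply: val_inj.
have := congr1 (fun X => submxcol X (Ordinal (kd : (k < d)%N))) BU.
rewrite /B /A mxcolK -submxcol_mul mxcolK => e.
have -> : Ordinal kd = lift ord0 (Ordinal (kd : (k < d)%N)) by apply: val_inj.
rewrite e; have -> : widen_ord (leqnSn d) (Ordinal (kd : (k < d)%N)) = Ordinal (ltnW kd).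
  by apply: val_inj.
by rewrite IH /= exprSr -mulmxA.
Qed.

End ToeplitzUnitary.

(** * The finite-dimensional space of the dilation *)

Section RowHilbert.
Local Open Scope sesquilinear_scope.
Context (R : realType) (D : nat).

Definition row_dot : {dot 'rV[R[i]]_D for Num.Def.conjC} := @dotmx R[i] D.

Lemma row_dotE (u v : 'rV[R[i]]_D) : row_dot u v = (u *m v^t*) 0 0.
Proof. exact: dotmxE. Qed.

Lemma row_dot_adj (u v : 'rV[R[i]]_D) (M : 'M_D) :
  row_dot (u *m M) v = row_dot u (v *m M^t*).
Proof. by rewrite !row_dotE adjmxM trmxCK mulmxA. Qed.

Lemma mulC_sqmod (c : R[i]) : c * conjc c = (sqmod c)%:C.
Proof.
case: c => a b; apply/eqP; rewrite eq_complex /=.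
by apply/andP; split; apply/eqP; rewrite /sqmod /=; ring.
Qed.

Lemma row_dot_sqmod (u : 'rV[R[i]]_D) : reform row_dot u u = \sum_k sqmod (u 0 k).
Proof.
have -> : reform row_dot u u = complex.Re (\sum_k u 0 k * conjc (u 0 k)).
  rewrite /reform row_dotE mxE; congr complex.Re.
  by apply: eq_bigr => k _; rewrite !mxE.
rewrite raddf_sum; apply: eq_bigr => k _.
by rewrite mulC_sqmod.
Qed.

Lemma row_dot_complete : dot_complete row_dot.
Proof.
have nE (x : 'rV[R[i]]_D) (e : R) : 0 < e ->
    (dot_norm row_dot x < e) = (\sum_k sqmod (x 0 k) < e ^+ 2).
  move=> e0; rewrite -row_dot_sqmod -(@ltr_pXn2r _ 2) ?nnegrE ?sqrtr_ge0 ?ltW //.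
  by rewrite sqr_sqrtr // (rform_ge0 (reform_realform _)).
move=> u cu.
have ex k : exists l : R[i], forall e : R, 0 < e -> exists m : nat, forall p : nat,
    (m <= p)%N -> sqmod (u p 0 k - l) < e.
  apply: complex_cauchy_cvg => e e0.
  have se : 0 < Num.sqrt e by rewrite sqrtr_gt0.
  have [m hm] := cu _ se; exists m => p q mp mq.
  have := hm p q mp mq; rewrite nE // sqr_sqrtr ?ltW //; apply: le_lt_trans.
  rewrite (bigD1 k) //= !mxE lerDl; apply: sumr_ge0 => j _; exact: sqmod_ge0.
have [l hl] := choice ex.
exists (\row_k l k) => e e0.
(* The successor keeps the sum of [D] terms strictly below [e ^+ 2], also for [D] equal to 0. *)
have e1 : 0 < e ^+ 2 / D.+1%:R by rewrite divr_gt0 ?exprn_gt0.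
have [m hm] := choice (fun k => hl k _ e1).
exists (\max_k m k) => p mp; rewrite nE //.
apply: (@le_lt_trans _ _ (\sum_(k < D) e ^+ 2 / D.+1%:R)).
  apply: ler_sum => k _; rewrite !mxE; apply: ltW; apply: hm.
  by apply: leq_trans mp; exact: leq_bigmax.
rewrite sumr_const card_ord -[ltLHS]mulr_natr -[ltRHS](divfK (_ : D.+1%:R != 0)) ?pnatr_eq0 //.
by rewrite ltr_pM2l // ltr_nat.
Qed.

Definition row_hilbert : hilbertSpace R := HilbertSpace row_dot_complete.

Lemma row_op_bounded (M : 'M[R[i]]_D) : M \is unitarymx ->
  @bounded_op R row_hilbert (fun x => x *m M).
Proof.
move=> uM; apply: stable_bounded_op; first by move=> a x y; rewrite mulmxDl scalemxAl.
exists 1 => // x; rewrite mul1r /reform row_dot_adj /=.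
by rewrite -mulmxA (unitarymxP uM) mulmx1.
Qed.

Lemma unitaryX (U : 'M[R[i]]_D) k : U \is unitarymx -> U ^+ k \is unitarymx.
Proof.
move=> uU; elim: k => [|k IH]; last by rewrite exprS mul_unitarymx.
by apply/unitarymxP; rewrite expr0 trmx1 map_mx1 mulmx1.
Qed.

Lemma row_op_normal (M : 'M[R[i]]_D) : M \is unitarymx ->
  @normal_op R row_hilbert (fun x => x *m M).
Proof.
move=> uM; have uM' : M^t* \is unitarymx by rewrite trmxC_unitary.
split; first exact: row_op_bounded.
exists (fun x => x *m M^t*).
  split; first exact: row_op_bounded.
  by move=> x y; exact: row_dot_adj.
by apply/funext => x /=; rewrite mulmxKtV // mulmxtVK.
Qed.

End RowHilbert.

(** * Characters and the powers of a unitary matrix *)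

Section GeneratedAlgebra.
Context (R : realType) (K : hilbertSpace R) (d : nat) (N : 'I_d -> K -> K).
Local Notation G := (cstar_generated N).

Lemma generated_gen k : G (N k).
Proof. by move=> X _; exact. Qed.

Lemma generated_id : G id.
Proof. by move=> X hX _; exact: cstar_one hX. Qed.

Lemma generatedD S T : G S -> G T -> G (S \+ T).
Proof. by move=> gS gT X hX hN; apply: (cstar_add hX); [exact: gS|exact: gT]. Qed.

Lemma generatedZ c T : G T -> G (c \*: T).
Proof. by move=> gT X hX hN; apply: (cstar_scale hX); exact: gT. Qed.

Lemma generatedM S T : G S -> G T -> G (S \o T).
Proof. by move=> gS gT X hX hN; apply: (cstar_mul hX); [exact: gS|exact: gT]. Qed.

(** [F] is the monic polynomial in [T] with roots [s]. Once it vanishes, the character must send [T]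
    to one of these roots. *)
Lemma uhom_prod pi (T : K -> K) (s : seq R[i]) : unital_hom G pi -> G T ->
  let F := foldr (fun c f => (T \+ (- c) \*: (@id K)) \o f) id s in
  G F /\ pi F = \prod_(c <- s) (pi T - c).
Proof.
move=> hpi gT /=; elim: s => [|c s [gF IH]] /=.
  by rewrite big_nil (uhom_one hpi); split=> //; exact: generated_id.
have gc : G ((- c) \*: (@id K)) by apply: generatedZ; exact: generated_id.
have gTc : G (T \+ (- c) \*: (@id K)) by exact: generatedD.
split; first exact: generatedM.
rewrite big_cons (uhom_mul hpi) // (uhom_add hpi) // (uhom_scale hpi).
  by rewrite (uhom_one hpi) mulr1 IH.
exact: generated_id.
Qed.

End GeneratedAlgebra.

Section UnitarySpectrum.
Local Open Scope sesquilinear_scope.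
Context (R : realType) (D d : nat).

Lemma unitary_powers_spectrum (U : 'M[R[i]]_D) : U \is unitarymx ->
  gelfand_spectrum (fun (k : 'I_d) (x : row_hilbert R D) => x *m U ^+ k.+1)
    `<=` moment_circle R d.
Proof.
move=> uU p [pi hpi ->].
(* Without coordinates there is no first operator to evaluate; the row space is then a single point,
   which lies on the curve. *)
case: (posnP d) => [d0|d0].
  exists 1; first exact: normr1.
  apply/rowP => k; have := leq_ltn_trans (leq0n k) (ltn_ord k).
  by rewrite lt0n => /eqP[].
pose N (k : 'I_d) (x : row_hilbert R D) : row_hilbert R D := x *m U ^+ k.+1.
pose T := N (Ordinal d0).
have gN k : cstar_generated N (N k) by exact: generated_gen.
have [P [L [uP UE L1]]] := unitary_diagonalization uU.
(* The eigenvalues with multiplicity: the corresponding polynomial annihilates the diagonal form of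
   [U]. *)
pose s := [seq L 0 i | i <- enum 'I_D].
have [gF piF] := uhom_prod s hpi (gN (Ordinal d0)).
have FE (r : seq 'I_D) (x : row_hilbert R D) :
    foldr (fun c f => (T \+ (- c) \*: (@id (row_hilbert R D))) \o f) id
      [seq L 0 i | i <- r] x
    = (x : 'rV_D) *m (P^t* *m diag_mx (\row_i \prod_(j <- r) (L 0 i - L 0 j)) *m P).
  elim: r => [|j r IH] /=.
    rewrite (_ : diag_mx _ = 1%:M); last first.
      by apply/matrixP => a b; rewrite !mxE big_nil.
    by rewrite mulmx1 -[P^t* *m P]mul1mx mulmxA mulmxKtV // mulmx1.
  rewrite IH /T /N /= expr1 -mulmxA scalemxAr -mulmxDr; congr (_ *m _).
  rewrite [X in _ *m X + _]UE !mulmxA mulmxtVK // -[_ *m _ *m diag_mx L]mulmxA mulmx_diag.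
  rewrite scalemxAl scalemxAr -mulmxDl -mulmxDr -linearZ -linearD.
  congr (_ *m diag_mx _ *m _); apply/rowP => i; rewrite !mxE big_cons; ring.
have F0 : foldr (fun c f => (T \+ (- c) \*: (@id (row_hilbert R D))) \o f) id s
    = 0 \*: (@id (row_hilbert R D)).
  apply/funext => x; rewrite /s FE /= scale0r (_ : diag_mx _ = 0).
    by rewrite mulmx0 mul0mx mulmx0.
  apply/matrixP => a b; rewrite !mxE.
  rewrite (bigD1_seq a) ?mem_enum ?enum_uniq //= subrr mul0r.
  by case: eqP.
rewrite F0 (uhom_scale hpi) in piF; last exact: generated_id.
rewrite mul0r big_map in piF.
have /eqP := esym piF; rewrite prodf_seq_eq0 => /hasP[l _ /= /eqP/subr0_eq pil].
exists (L 0 l); first exact: L1.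
apply/rowP => -[k kd]; rewrite !mxE -pil.
change (pi (N (Ordinal kd)) = pi T ^+ k.+1).
elim: k kd => [|k IH] kd.
  by rewrite expr1 /T; congr pi; apply/funext => x; rewrite /N.
have kd' := ltnW kd.
have -> : N (Ordinal kd) = N (Ordinal kd') \o T.
  by apply/funext => x; rewrite /N /T /N /= expr1 [in LHS]exprS mulmxA.
rewrite (uhom_mul hpi); [|exact: gN..].
by rewrite (IH kd') [RHS]exprSr.
Qed.

End UnitarySpectrum.

(** * Toeplitz modulus and numerical radius *)

Section Cdot.
Local Open Scope sesquilinear_scope.
Context (R : realType).
Local Arguments conjc : simpl never.

Lemma cdotE n (u v : 'cV[R[i]]_n) : cdot u v = (v^t* *m u) 0 0.
Proof.
rewrite /cdot dotmxE -[in RHS](trmxK (v^t* *m u)) [RHS]mxE trmx_mul.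
by congr (fun_of_matrix _ _ _); congr (_ *m _); apply/matrixP => a b; rewrite !mxE.
Qed.

Lemma cdot_adj m n (A : 'M[R[i]]_(m, n)) u v :
  cdot (A *m u) v = cdot u (A^t* *m v).
Proof. by rewrite !cdotE adjmxM trmxCK mulmxA. Qed.

Lemma cdotC n (u v : 'cV[R[i]]_n) : cdot v u = conjc (cdot u v).
Proof. exact: (dotC (row_dot R n)). Qed.

Lemma cdotDl n (u v w : 'cV[R[i]]_n) : cdot (u + v) w = cdot u w + cdot v w.
Proof. by rewrite !cdotE mulmxDr mxE. Qed.

Lemma cdot0l n (w : 'cV[R[i]]_n) : cdot 0 w = 0.
Proof. by rewrite cdotE mulmx0 mxE. Qed.

Lemma cdotZl n c (u v : 'cV[R[i]]_n) : cdot (c *: u) v = c * cdot u v.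
Proof. by rewrite !cdotE -scalemxAr mxE. Qed.

Lemma cdotZr n c (u v : 'cV[R[i]]_n) : cdot u (c *: v) = conjc c * cdot u v.
Proof. by rewrite cdotC cdotZl conjcM -cdotC. Qed.

Lemma cdot_suml n (I : finType) (P : pred I) (f : I -> 'cV[R[i]]_n) w :
  cdot (\sum_(i | P i) f i) w = \sum_(i | P i) cdot (f i) w.
Proof.
by apply: (big_morph (fun u => cdot u w)) => [u v|]; rewrite ?cdotDl ?cdot0l.
Qed.

Definition cform n (u v : 'cV[R[i]]_n) : R := complex.Re (cdot u v).

Lemma cform_realform n : realform (@cform n).
Proof.
have rg := reform_realform (row_dot R n).
have E u v : @cform n u v = reform (row_dot R n) u^T v^T by [].
split=> [x y|x y z|a x y|x y|x]; rewrite !E ?linearD ?linearZ /=.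
- exact: rformC.
- exact: rformD.
- exact: rformZ.
- exact: rformI.
- exact: rform_ge0.
Qed.

Lemma psd_real n (M : 'M[R[i]]_n) : M^t* = M ->
  psd M <-> forall x, 0 <= cform (M *m x) x.
Proof.
move=> hM; split=> pM x; have := pM x; first by rewrite lecE => /andP[].
have : cdot (M *m x) x = conjc (cdot (M *m x) x).
  by rewrite -cdotC cdot_adj hM.
rewrite /cform lecE; case: (cdot _ _) => a b [] /= h -> ; rewrite andbT.
by apply/eqP; lra.
Qed.

Lemma cdot_mxcol m n (u v : 'I_m -> 'cV[R[i]]_n) :
  cdot (\mxcol_i u i) (\mxcol_i v i) = \sum_i cdot (u i) (v i).
Proof.
rewrite cdotE adj_mxcol mul_mxrow_mxcol summxE.
by apply: eq_bigr => i _; rewrite cdotE.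
Qed.

Lemma cform_mxcol m n (u v : 'I_m -> 'cV[R[i]]_n) :
  cform (\mxcol_i u i) (\mxcol_i v i) = \sum_i cform (u i) (v i).
Proof.
rewrite /cform cdot_mxcol.
by apply: (big_morph (@complex.Re R)) => // -[a b] [a' b'].
Qed.

Lemma cform_adj m n (A : 'M[R[i]]_(m, n)) u v :
  cform (A *m u) v = cform u (A^t* *m v).
Proof. by rewrite /cform cdot_adj. Qed.

Lemma mulmx_stable n (H : 'M[R[i]]_n) : stable (fun x => cform x x) (mulmx H).
Proof.
have rg := cform_realform n; have nsn := rform_sqsn rg.
pose S := \sum_k cform (col k H) (col k H).
have S0 : 0 <= S by apply: sumr_ge0 => k _; exact: (rform_ge0 rg).
exists (2 ^+ n * S); first by rewrite mulr_ge0 // exprn_ge0.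
move=> x.
have -> : H *m x = \sum_k x k 0 *: col k H.
  apply/colP => i; rewrite mxE summxE; apply: eq_bigr => k _.
  by rewrite !mxE mulrC.
apply: le_trans (sqsn_sum nsn _) _; rewrite -mulrA ler_wpM2l ?exprn_ge0 //.
rewrite mulr_suml; apply: ler_sum => k _; rewrite (sqsnZ nsn) mulrC.
apply: ler_wpM2l; first exact: (rform_ge0 rg).
have -> : cform x x = reform (row_dot R n) x^T x^T by [].
rewrite row_dot_sqmod (bigD1 k) //= mxE lerDl.
by apply: sumr_ge0 => j _; exact: sqmod_ge0.
Qed.

End Cdot.

Section ToeplitzForms.
Local Open Scope sesquilinear_scope.
Context (R : realType) (d n : nat).
Implicit Types (T : d.-tuple 'M[R[i]]_n).

Definition toepT (D : 'M[R[i]]_n) T (i j : nat) : 'M[R[i]]_n :=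
  toep D (fun k => T`_k) (fun k => (T`_k)^t*) i j.

Lemma toeplitz_op_mxblock a T :
  toeplitz_op a T = \mxblock_(i < d.+1, j < d.+1) toepT (a%:C)%:M T i j.
Proof. by []. Qed.

Lemma adj_toepT D T i j : D^t* = D -> (toepT D T i j)^t* = toepT D T j i.
Proof.
by move=> hD; rewrite /toepT /toep; case: (ltngtP i j) => // _; rewrite trmxCK.
Qed.

Lemma adj_real_scalar (a : R) : ((a%:C)%:M : 'M[R[i]]_n)^t* = (a%:C)%:M.
Proof.
rewrite tr_scalar_mx map_scalar_mx; congr (_ %:M).
by rewrite -[RHS]conjc_real.
Qed.

Lemma toeplitz_op_herm a T : (toeplitz_op a T)^t* = toeplitz_op a T.
Proof.
rewrite toeplitz_op_mxblock tr_mxblock.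
rewrite (_ : map_mx _ _ = \mxblock_(i < d.+1, j < d.+1) (toepT (a%:C)%:M T j i)^t*).
  by apply: eq_mxblock => i j; rewrite adj_toepT // adj_real_scalar.
by apply/matrixP => s t; rewrite !mxE.
Qed.

Lemma cdot_toeplitz_op a T (u : 'I_d.+1 -> 'cV[R[i]]_n) :
  cdot (toeplitz_op a T *m \mxcol_i u i) (\mxcol_i u i)
  = \sum_(i < d.+1) \sum_(j < d.+1) cdot (toepT (a%:C)%:M T i j *m u j) (u i).
Proof.
rewrite toeplitz_op_mxblock mul_mxblock_mxrow cdot_mxcol.
by apply: eq_bigr => i _; rewrite cdot_suml.
Qed.

Lemma cform_toeplitz_op_sum a T (u : 'I_d.+1 -> 'cV[R[i]]_n) :
  cform (toeplitz_op a T *m \mxcol_i u i) (\mxcol_i u i)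
  = \sum_(i < d.+1) \sum_(j < d.+1) cform (toepT (a%:C)%:M T i j *m u j) (u i).
Proof.
rewrite toeplitz_op_mxblock mul_mxblock_mxrow cform_mxcol.
by apply: eq_bigr => i _; rewrite (rform_suml (cform_realform R n)).
Qed.

(** The parameter sits on the diagonal only, so the form is affine in it; this is what controls both
    infima. *)
Lemma cform_toeplitz_op a T X :
  cform (toeplitz_op a T *m X) X = a * cform X X + cform (toeplitz_op 0 T *m X) X.
Proof.
rewrite -(submxcolK X); move: (submxcol X) => u.
rewrite !cform_toeplitz_op_sum cform_mxcol mulr_sumr -big_split.
apply: eq_bigr => i _.
have rg := cform_realform R n.
have eD D : toepT D T i i = D by rewrite /toepT /toep eqxx.
transitivity (\sum_(j < d.+1) ((if j == i then a * cform (u i) (u i) else 0)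
    + cform (toepT (0%:C)%:M T i j *m u j) (u i))).
  apply: eq_bigr => j _; case: eqVneq => [->|ji].
    by rewrite !eD !mul_scalar_mx !(rformZ rg) mul0r addr0.
  by rewrite add0r /toepT /toep (_ : (i == j :> nat) = false) // eq_sym; exact/negbTE.
by rewrite big_split -big_mkcond big_pred1_eq.
Qed.

(** The product of <T xi, xi>, x_j and conj(x_i) pairs T (x_j xi) with x_i xi. The unit norm of [xi]
    accounts for the diagonal. *)
Lemma cdot_toeplitz_vec a T xi (x : 'cV[R[i]]_d.+1) : cdot xi xi = 1 ->
  cdot (toeplitz_vec a T xi *m x) x
  = cdot (toeplitz_op a T *m \mxcol_(i < d.+1) (x i 0 *: xi)) (\mxcol_i (x i 0 *: xi)).
Proof.
move=> xi1; rewrite (cdot_toeplitz_op a T (fun i => x i 0 *: xi)).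
rewrite cdotE mxE; apply: eq_bigr => i _; rewrite !mxE mulr_sumr.
apply: eq_bigr => j _; rewrite -scalemxAr cdotZl cdotZr !mxE.
rewrite [x j 0 * _]mulrCA; congr (_ * _); rewrite mulrC; congr (_ * _).
rewrite /toepT /toep; case: eqP => [ij|/eqP ij].
  by rewrite ij eqxx mul_scalar_mx cdotZl xi1 mulr1.
by rewrite (negbTE (ij : i != j :> nat)); case: ifP.
Qed.

Lemma toeplitz_vec_herm a T xi : (toeplitz_vec a T xi)^t* = toeplitz_vec a T xi.
Proof.
apply/matrixP => i j; rewrite !mxE -!val_eqE /=.
have C (z : R[i]) : (z^*)%R = conjc z by [].
rewrite C; case: (ltngtP i j) => ij.
- by rewrite -cdotC [RHS]cdot_adj ?trmxCK.
- by rewrite -cdotC [RHS]cdot_adj ?trmxCK.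
- exact: conjc_real.
Qed.

(* Both sets of admissible alphas have the form {a >= 0 : a |X|^2 + q X >= 0
   for all X in S}, where q is the quadratic form of toeplitz_op 0 T and, for
   the numerical radius, S consists of the elementary tensors of x and xi. *)
Lemma inf_toeplitz_le1 T (S : set 'cV[R[i]]_(\sum_(i < d.+1) n)) :
  inf [set a : R | 0 <= a /\
         forall X, S X -> 0 <= cform (toeplitz_op a T *m X) X] <= 1 <->
  forall X, S X -> 0 <= cform (toeplitz_op 1 T *m X) X.
Proof.
have rg := cform_realform R (\sum_(i < d.+1) n).
set A := [set a | _].
have lbA : has_lbound A by exists 0 => a [].
split=> [A1 X SX|h]; last by apply: ge_inf => //; split.
have [M M0 hM] := mulmx_stable (toeplitz_op 0 T).
(* The infimum of an empty set would carry no information; [M + 1] is admissible because it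
   dominates the off-diagonal part. *)
have neA : A !=set0.
  exists (M + 1); split=> [|Y _]; first lra.
  rewrite cform_toeplitz_op.
  have := rform_amgm rg (- (toeplitz_op 0 T *m Y)) Y ltr01.
  rewrite mul1r divr1 !(rformN rg) (rformNr rg) opprK.
  have := hM Y; have := rform_ge0 rg Y; have := mulr_ge0 M0 (rform_ge0 rg Y).
  move: (cform (toeplitz_op 0 T *m Y) Y) (cform (_ *m Y) (_ *m Y)) (cform Y Y).
  by clear=> q r s h1 h2 h3 h4; lra.
rewrite leNgt; apply/negP => q0.
have nX := rform_ge0 rg X.
(* Any parameter below 1 + e still makes the form negative at [X]; the added 1 avoids division by a
   vanishing norm. *)
pose e := - cform (toeplitz_op 1 T *m X) X / (cform X X + 1).
have e0 : 0 < e by rewrite divr_gt0 ?oppr_gt0 // ltr_wpDl.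
have [a [a0 /(_ X SX)]] := inf_adherent e0 (conj neA lbA).
have eE : e * (cform X X + 1) = - cform (toeplitz_op 1 T *m X) X.
  by rewrite divfK // gt_eqF // ltr_wpDl.
move: q0 eE e0; rewrite (cform_toeplitz_op 1) (cform_toeplitz_op a) mul1r.
clearbody e; move: (cform (_ *m X) X) (cform X X) (inf A) nX A1; clear.
move=> q s b s0 b1 q0 eE e0 ha ab.
have : (a - 1) * s <= e * s by rewrite ler_wpM2r //; lra.
lra.
Qed.

Lemma toeplitz_modulus_le1 T : toeplitz_modulus T <= 1 <-> psd (toeplitz_op 1 T).
Proof.
rewrite (psd_real (toeplitz_op_herm 1 T)).
have := inf_toeplitz_le1 T setT; rewrite /toeplitz_modulus.
have -> : [set a : R | 0 <= a /\ forall X, setT X ->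
             0 <= cform (toeplitz_op a T *m X) X]
    = [set a | 0 <= a /\ psd (toeplitz_op a T)].
  apply/funext => a; apply/propext.
  rewrite /= (psd_real (toeplitz_op_herm a T)).
  by split=> -[a0 h]; split=> // X *; exact: h.
by move=> ->; split=> h X *; exact: h.
Qed.

Lemma toeplitz_numradius_le1 T : toeplitz_numradius T <= 1 <->
  forall xi, cdot xi xi = 1 -> psd (toeplitz_vec 1 T xi).
Proof.
pose S : set 'cV[R[i]]_(\sum_(i < d.+1) n) := [set X | exists xi (x : 'cV_d.+1),
  cdot xi xi = 1 /\ X = \mxcol_(i < d.+1) (x i 0 *: xi)].
have psdE a : (forall X, S X -> 0 <= cform (toeplitz_op a T *m X) X) <->
    forall xi, cdot xi xi = 1 -> psd (toeplitz_vec a T xi).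
  split=> [h xi xi1|h X [xi [x [xi1 ->]]]].
    rewrite (psd_real (toeplitz_vec_herm a T xi)) => x.
    by rewrite /cform cdot_toeplitz_vec //; apply: h; exists xi, x.
  have /(psd_real (toeplitz_vec_herm a T xi))/(_ x) := h xi xi1.
  by rewrite /cform cdot_toeplitz_vec.
rewrite -psdE -inf_toeplitz_le1 /toeplitz_numradius.
have -> // : [set a : R | 0 <= a /\
     forall xi, cdot xi xi = 1 -> psd (toeplitz_vec a T xi)]
  = [set a | 0 <= a /\ forall X, S X -> 0 <= cform (toeplitz_op a T *m X) X].
by apply/funext => a; apply/propext; rewrite /= psdE.
Qed.

End ToeplitzForms.

(** * The implications of the two equivalences *)

Section Directions.
Local Open Scope sesquilinear_scope.
Context (R : realType) (d n : nat).
Local Arguments conjc : simpl never.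
Implicit Types (A B : d.-tuple 'M[R[i]]_n).

(** On vectors with components in the range of [iota], the form of the operator Toeplitz matrix of
    the dilation is that of [toeplitz_op 1 A]: positivity passes to the compression. *)
Lemma Kmin_psd A :
  Kmin (conv_hull (moment_circle R d)) A -> psd (toeplitz_op 1 A).
Proof.
move=> [K [iota [N [[iso nN cN proj] spec]]]].
rewrite (psd_real (toeplitz_op_herm 1 A)) => X.
rewrite -(submxcolK X) cform_toeplitz_op_sum; move: (submxcol X) => u.
pose g := reform (hdot K); have rg : realform g by exact: reform_realform.
(* The tuple is extended by the zero operator, which is normal and commutes with the others; the
   matrix only uses indices below [d]. *)
pose NN (k : nat) : K -> K := if insub k is Some i then N i else fun=> 0.
have NNE k (kd : (k < d)%N) : NN k = N (Ordinal kd).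
  by rewrite /NN insubT.
have NN0 k : (d <= k)%N -> NN k = fun=> 0.
  by move=> dk; rewrite /NN insubF // ltnNge dk.
have g0 (x : K) : g 0 x = 0 by have := rformZ rg 0 0 x; rewrite rmorph0 scale0r mul0r.
have ex k : exists S, normal_pair g (NN k) S.
  have [kd|dk] := ltnP k d; first by rewrite (NNE k kd); exact: normal_op_pair.
  rewrite NN0 //; exists (fun=> 0).
  have st : stable (fun x : K => g x x) (fun=> 0).
    by exists 0 => // x; rewrite g0 mul0r.
  split=> //; try by move=> a x y; rewrite scaler0 addr0.
  by move=> x y; rewrite g0 (rformC rg) g0.
have [NN' np] := choice ex.
have cNN j k x : NN j (NN k x) = NN k (NN j x).
  have [kd|dk] := ltnP k d; last by rewrite (NN0 k dk) (lin0 (np_lin (np j))).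
  have [jd|dj] := ltnP j d; last by rewrite (NN0 j dj) (lin0 (np_lin (np k))).
  by rewrite !NNE; exact: (congr1 (fun f => f x) (cN (Ordinal jd) (Ordinal kd))).
have NNio k (v w : 'cV[R[i]]_n) : (k < d)%N ->
    g (NN k (iota v)) (iota w) = cform (A`_k *m v) w.
  move=> kd; have [_ /(_ (iota w))] := proj (Ordinal kd) v.
  have rw : range iota (iota w) by exists w.
  have dotB (a b c : K) : hdot K (a - b) c = hdot K a c - hdot K b c.
    exact: linearBl.
  move=> /(_ rw); rewrite dotB iso => /subr0_eq h.
  by rewrite /g /reform NNE h (tnth_nth 0).
have NN'io k (v w : 'cV[R[i]]_n) : (k < d)%N ->
    g (NN' k (iota v)) (iota w) = cform ((A`_k)^t* *m v) w.
  move=> kd; apply: etrans (np_adj' rg (np k) _ _) _.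
  apply: etrans (rformC rg _ _) _; rewrite NNio // cform_adj.
  exact: (rformC (cform_realform R n)).
have spec' (c : nat -> R[i]) :
    (forall e : R, 0 < e -> exists x, \sum_(k < d) g (NN k x - c k *: x) (NN k x - c k *: x)
       < e * g x x) -> conv_hull (moment_circle R d) (\row_(k < d) c k).
  move=> h; apply: spec; apply: (@approx_joint_eigenvalue_gelfand R K d N) => // e /h[x hx].
  exists x; apply: le_lt_trans hx; rewrite le_eqVlt; apply/orP; left; apply/eqP.
  by apply: eq_bigr => k _; rewrite (NNE k (ltn_ord k)); congr (g (N _ _ - _) (N _ _ - _));
     apply: val_inj.
have := toep_op_ge0 rg (@reform_def _ _ (hdot K)) np cNN spec' (fun i => iota (u i)).
congr (0 <= _); apply: eq_bigr => i _; apply: eq_bigr => j _.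
have ltd (a b : 'I_d.+1) : (b < a)%N -> ((a - b).-1 < d)%N.
  move=> ba; have := ltn_ord a; rewrite ltnS => ad.
  by rewrite prednK ?subn_gt0 // (leq_trans (leq_subr _ _)).
rewrite /toepT /toep; case: (ltngtP j i) => ij.
- by rewrite NNio // ltd.
- by rewrite NN'io // ltd.
- by rewrite mul1mx /g /reform iso.
Qed.

Lemma psd_Kmin A :
  psd (toeplitz_op 1 A) -> Kmin (conv_hull (moment_circle R d)) A.
Proof.
move=> pA.
have [|Y AY] := psd_gram (esym (toeplitz_op_herm 1 A)).
  by move=> x; rewrite -mulmxA -cdotE.
pose r (i : 'I_d.+1) := submxcol Y i.
have rr i j : r i *m (r j)^t* = toepT 1%:M A i j.
  move: i j; apply/eq_mxblockP.
  rewrite -mul_mxcol_mxrow -adj_mxcol submxcolK -AY.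
  by rewrite toeplitz_op_mxblock.
have [U uU rU] := toeplitz_unitary rr.
(* Vectors are columns in C^n but rows in the dilation space. The conjugate and the transpose make
   the scalar product of [iota u *m V ^+ k] and [iota v] equal to v^* r_k r_0^* u. *)
pose Z := r ord0; pose Zc := map_mx Num.conj Z; pose V := U^T.
have uV : V \is unitarymx by rewrite trmx_unitary.
have VX k : V ^+ k = (U ^+ k)^T.
  elim: k => [|k IH]; first by rewrite !expr0 trmx1.
  by rewrite exprS exprSr IH trmx_mul.
set D := (\sum_(i < d.+1) n)%N in Y AY r rr U uU rU Z Zc V uV VX *.
pose iota : {linear 'cV[R[i]]_n -> row_hilbert R D} := mulmxr Zc \o trmx.
have ZcE : Zc^t* = Z^T by apply/matrixP => a b; rewrite !mxE conjCK.
have iotaE (k : 'I_d.+1) (u v : 'cV[R[i]]_n) :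
    row_dot R D (iota u *m V ^+ k) (iota v) = cdot (toepT 1%:M A k (ord0 : 'I_d.+1) *m u) v.
  rewrite row_dotE cdotE -rr rU -/Z adjmxM ZcE VX /=.
  rewrite -[in RHS](trmxK (_ *m _)) [RHS]mxE !trmx_mul.
  have -> : (Z^t*)^T = Zc by apply/matrixP => a b; rewrite !mxE.
  have -> : (v^t*)^T = (v^T)^t* by apply/matrixP => a b; rewrite !mxE.
  by rewrite !mulmxA.
have iso u v : row_dot R D (iota u) (iota v) = cdot u v.
  have := iotaE ord0 u v; rewrite expr0 mulmx1 => ->.
  by rewrite /toepT /toep eqxx mul1mx.
exists (row_hilbert R D), iota, (fun k x => x *m V ^+ k.+1); split; last first.
  move=> p /(unitary_powers_spectrum uV) hp.
  exists 1%N, (fun=> 1), (fun=> p); split=> //; first by rewrite big_ord1.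
  by rewrite big_ord1 scale1r.
split.
- exact: iso.
- by move=> k; apply: row_op_normal; exact: unitaryX.
- move=> j k; apply/funext => x /=; rewrite -!mulmxA; congr (_ *m _).
  have : V ^+ k.+1 * V ^+ j.+1 = V ^+ j.+1 * V ^+ k.+1 by rewrite -!exprD addnC.
  exact.
- move=> k xi; split; first by exists (tnth A k *m xi).
  move=> _ [eta _ <-].
  have dotB (a b c : 'rV[R[i]]_D) : row_dot R D (a - b) c = row_dot R D a c - row_dot R D b c.
    exact: linearBl.
  apply: etrans (dotB _ _ _) _; rewrite iso (iotaE (lift ord0 k)).
  rewrite /toepT /toep /= /bump /= ?add1n ?subn0 (tnth_nth 0) subrr //.
Qed.

Lemma Re_sum (I : finType) (P : pred I) (f : I -> R[i]) :
  complex.Re (\sum_(i | P i) f i) = \sum_(i | P i) complex.Re (f i).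
Proof. by apply: (big_morph (@complex.Re R)) => // -[a b] [a' b']. Qed.

Lemma toeplitz_vec_toep B xi (i j : 'I_d.+1) :
  toeplitz_vec 1 B xi i j
  = toep 1 (fun k => cdot (B`_k *m xi) xi) (fun k => conjc (cdot (B`_k *m xi) xi)) i j.
Proof.
rewrite mxE -val_eqE /= /toep; case: (ltngtP i j) => ij //.
by rewrite -cdotC cdot_adj trmxCK.
Qed.

Lemma Kmax_psd B xi : Kmax (conv_hull (moment_circle R d)) B ->
  cdot xi xi = 1 -> psd (toeplitz_vec 1 B xi).
Proof.
move=> hB xi1; rewrite (psd_real (toeplitz_vec_herm 1 B xi)) => x.
pose p : 'rV[R[i]]_d := \row_(k < d) cdot (tnth B k *m xi) xi.
have pO : conv_hull (moment_circle R d) p by apply: hB; exists xi.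
have rg := cform_realform R 1.
have cp (k : 'I_d) : cdot (B`_k *m xi) xi = p 0 k by rewrite mxE (tnth_nth 0).
have := conv_toep_ge0 (c := fun k => cdot (B`_k *m xi) xi) rg (fun i => (x i 0)%:M) pO cp.
congr (0 <= _); rewrite /cform cdotE mxE Re_sum; apply: eq_bigr => i _.
rewrite -Re_sum; congr complex.Re; rewrite !mxE mulr_sumr.
apply: eq_bigr => j _; rewrite cdotE -scalemxAr mxE toeplitz_vec_toep.
rewrite mulrCA; congr (_ * _).
by rewrite mxE big_ord1 !mxE mulr1n.
Qed.

Lemma psd_Kmax B : (forall xi, cdot xi xi = 1 -> psd (toeplitz_vec 1 B xi)) ->
  Kmax (conv_hull (moment_circle R d)) B.
Proof.
move=> hB _ [xi xi1 ->].
have [|Y MY] := psd_gram (esym (toeplitz_vec_herm 1 B xi)).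
  by move=> x; rewrite -mulmxA -cdotE; exact: hB.
pose c k := cdot (B`_k *m xi) xi.
have rr i j : row i Y *m (row j Y)^t*
    = toep 1%:M (fun k => (c k)%:M) (fun k => (conjc (c k))%:M) i j.
  apply/matrixP => a b; rewrite !ord1.
  have e : toep 1 c (fun k => conjc (c k)) i j = \sum_k Y i k * (Y^t*) k j.
    by rewrite -(toeplitz_vec_toep B xi i j) MY mxE.
  transitivity (\sum_k Y i k * (Y^t*) k j).
    by rewrite mxE; apply: eq_bigr => k _; rewrite !mxE.
  rewrite -e /toep; case: (ltngtP i j) => _; by rewrite mxE eqxx.
have [U uU rU] := toeplitz_unitary rr.
have [P [L [uP UE L1]]] := unitary_diagonalization uU.
(* The coordinates of the first row in an eigenbasis of [U]. Their squared moduli form its spectral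
   measure: the moment of order 0 is the diagonal entry 1, and that of order k + 1 is [c k]. *)
pose v := row ord0 Y *m P^t*.
have UX k := unitary_conj_diagX L k uP.
have vE k : (row ord0 Y *m U ^+ k *m (row ord0 Y)^t*) 0 0
    = \sum_l (sqmod (v 0 l))%:C * L 0 l ^+ k.
  have -> : row ord0 Y *m U ^+ k *m (row ord0 Y)^t*
      = v *m diag_mx (\row_i (L 0 i) ^+ k) *m v^t*.
    by rewrite {1}UE UX /v adjmxM trmxCK !mulmxA.
  rewrite mxE; apply: eq_bigr => l _.
  rewrite mul_mx_diag !mxE -mulC_sqmod mulrAC; congr (_ * _ * _).
pose t l := sqmod (v 0 l).
exists d.+1, t, (fun l => \row_(k < d) (L 0 l) ^+ k.+1); split.
- by move=> l; exact: sqmod_ge0.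
- have := vE 0%N; rewrite expr0 mulmx1 rr /toep eqxx mxE eqxx mulr1n.
  under eq_bigr do rewrite expr0 mulr1.
  by move=> /(congr1 (@complex.Re R)); rewrite Re_sum => e; exact: esym e.
- by move=> l; exists (L 0 l).
- apply/rowP => k; rewrite mxE summxE.
  have := vE k.+1; rewrite -(rU (lift ord0 k)) rr /toep /= /bump /= ?add1n ?subn0.
  rewrite mxE eqxx mulr1n /c (tnth_nth 0) => ->.
  by under [RHS]eq_bigr do rewrite !mxE.
Qed.

End Directions.

Theorem theorem5p8 (R : realType) (d n : nat) (A B : d.-tuple 'M[R[i]]_n) :
  (Kmin (conv_hull (moment_circle R d)) A <-> toeplitz_modulus A <= 1) /\
  (Kmax (conv_hull (moment_circle R d)) B <-> toeplitz_numradius B <= 1).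
Proof.
split.
  rewrite toeplitz_modulus_le1.
  by split; [exact: Kmin_psd | exact: psd_Kmin].
rewrite toeplitz_numradius_le1.
by split=> [hB xi|]; [exact: Kmax_psd | exact: psd_Kmax].
Qed.
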